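(* Let $c\in\{1,-1\}$, let $\mathbb{M}^{n+1}_c$ denote the unit sphere $\mathbb{S}^{n+1}\subset\mathbb{R}^{n+2}$ if $c=1$ and the hyperbolic space $\mathbb{H}^{n+1}\subset\mathbb{R}^{n+2}_1$ if $c=-1$, and let $x:M^n\to\mathbb{M}^{n+1}_c\subset\mathbb{R}^{n+2}_q$ (with $q=0$ if $c=1$ and $q=1$ if $c=-1$) be a connected orientable immersed hypersurface. Fix $k\in\{0,\ldots,n-1\}$ and let $L_k$ be the linearized operator of the $(k+1)$-th mean curvature of $M$. Assume that $H_k$ is constant. Then there exist a self-adjoint constant matrix $A\in\mathbb{R}^{(n+2)\times(n+2)}$ and a non-zero constant vector $b\in\mathbb{R}^{n+2}$ such that $L_kx=Ax+b$ on $M$ if and only if: (i) $c=1$ and the hypersurface is an open piece of a totally umbilical round sphere $\mathbb{S}^{n}(r)\subset\mathbb{S}^{n+1}$, $0<r<1$; or (ii) $c=-1$ and the hypersurface is one of the following hypersurfaces in $\mathbb{H}^{n+1}$: (1) an open piece of a totally umbilical hyperbolic space $\mathbb{H}^{n}(-r)$, $r>1$; (2) an open piece of a totally umbilical round sphere $\mathbb{S}^{n}(r)$, $r>0$; (3) an open piece of a totally umbilical Euclidean space $\mathbb{R}^{n}$.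
   Context: Ambient spaces: $\mathbb{R}^{n+2}_0=\mathbb{R}^{n+2}$ is Euclidean space and $\mathbb{R}^{n+2}_1$ is $\mathbb{R}^{n+2}$ with coordinates $(x_0,\ldots,x_{n+1})$ and the Lorentzian metric $\langle\,,\rangle=-dx_0^2+dx_1^2+\cdots+dx_{n+1}^2$. $\mathbb{S}^{n+1}=\{x\in\mathbb{R}^{n+2}:\langle x,x\rangle=1\}$ and $\mathbb{H}^{n+1}=\{x\in\mathbb{R}^{n+2}_1:\langle x,x\rangle=-1,\ x_0>0\}$. A matrix $A$ is self-adjoint if $\langle Av,w\rangle=\langle v,Aw\rangle$ for all $v,w$, with respect to the metric $\langle\,,\rangle$ of $\mathbb{R}^{n+2}_q$. Curvatures: $N$ is a chosen unit normal field of $M$ in $\mathbb{M}^{n+1}_c$ (Gauss map), $S X=-\overline{\nabla}_XN$ is the shape operator ($\overline{\nabla}$ the Levi-Civita connection of $\mathbb{M}^{n+1}_c$), with eigenvalues $\kappa_1,\ldots,\kappa_n$ (principal curvatures). Put $s_0=1$, $s_k=\sigma_k(\kappa_1,\ldots,\kappa_n)$ with $\sigma_k$ the $k$-th elementary symmetric function; the $k$-th mean curvature $H_k$ is defined by $\binom{n}{k}H_k=s_k$, $0\le k\le n$. Operator: the Newton transformations are $P_0=I$, $P_k=s_kI-S\circ P_{k-1}$. For $f\in C^\infty(M)$, $L_k f=\mathrm{trace}(P_k\circ\nabla^2 f)$, where $\nabla^2f$ is the self-adjoint endomorphism $X\mapsto\nabla_X\nabla f$ of $TM$ (Hessian of $f$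 in the induced metric). $L_kx$ is computed componentwise on the $\mathbb{R}^{n+2}$-valued position vector $x$. Totally umbilical hypersurfaces: in $\mathbb{S}^{n+1}$, the totally umbilical $\mathbb{S}^n(r)$ is $\{x\in\mathbb{S}^{n+1}:\langle a,x\rangle=\tau\}$ with $\langle a,a\rangle=1$, $\tau\in(-1,1)$, $r=\sqrt{1-\tau^2}$. In $\mathbb{H}^{n+1}$, consider non-empty sets $M_\tau=\{x\in\mathbb{H}^{n+1}:\langle a,x\rangle=\tau\}$ with $a\in\mathbb{R}^{n+2}_1$ a non-zero constant vector: if $\langle a,a\rangle=1$, $M_\tau$ is the totally umbilical hyperbolic space $\mathbb{H}^n(-r)$ with $r=\sqrt{1+\tau^2}$; if $\langle a,a\rangle=-1$ and $|\tau|>1$, it is the totally umbilical round sphere $\mathbb{S}^n(r)$ with $r=\sqrt{\tau^2-1}$; if $\langle a,a\rangle=0$ and $\tau\neq0$, it is a totally umbilical Euclidean space $\mathbb{R}^n$. ''Open piece'' means that $x(M)$ is an open subset of the given hypersurface. *)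

(* Defs.v *)
From HB Require Import structures.
From mathcomp Require Import all_boot all_order all_algebra.
From mathcomp Require Import all_classical all_reals all_analysis.

Set Implicit Arguments.
Unset Strict Implicit.
Unset Printing Implicit Defensive.

Import Order.TTheory GRing.Theory Num.Theory.
Import numFieldNormedType.Exports.

Local Open Scope classical_set_scope.
Local Open Scope ring_scope.

Section Smoothness.
Context {R : realType} {n : nat} {V : normedModType R}.

Definition partial (i : 'I_n) (f : 'rV[R]_n -> V) : 'rV[R]_n -> V :=
  fun u => 'D_(delta_mx 0 i) f u.

(* C^oo on an open set U: every iterated partial derivative is (Frechet)
   differentiable at every point of U.  Differentiability gives the continuity
   of each iterated partial and the existence of the next ones. *)
Definition smooth_on (U : set 'rV[R]_n) (f : 'rV[R]_n -> V) : Prop :=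
  forall (s : seq 'I_n) (u : 'rV[R]_n),
    U u -> differentiable (foldr partial f s) u.

End Smoothness.

Section Manifold.
Context {R : realType} {n : nat} {M : topologicalType}.

(* [coords] and [param] are total functions, meaningful on [src] and [tgt] only. *)
Record chart := Chart {
  src : set M;
  tgt : set 'rV[R]_n;
  coords : M -> 'rV[R]_n;
  param : 'rV[R]_n -> M;
  src_open : open src;
  tgt_open : open tgt;
  coords_tgt : forall p, src p -> tgt (coords p);
  param_src : forall u, tgt u -> src (param u);
  coordsK : forall p, src p -> param (coords p) = p;
  paramK : forall u, tgt u -> coords (param u) = u;
  coords_continuous : {within src, continuous coords};
  param_continuous : {within tgt, continuous param}
}.

Definition smooth_atlas (atlas : set chart) : Prop :=
  (forall p : M, exists2 phi, atlas phi & src phi p) /\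
  (forall phi psi, atlas phi -> atlas psi ->
     smooth_on (tgt phi `&` param phi @^-1` src psi) (coords psi \o param phi)).

Definition smooth_manifold (atlas : set chart) : Prop :=
  [/\ hausdorff_space M, @second_countable M & smooth_atlas atlas].

Definition smooth_map {V : normedModType R} (atlas : set chart) (f : M -> V) :=
  forall phi, atlas phi -> smooth_on (tgt phi) (f \o param phi).

Definition immersion {V : normedModType R} (atlas : set chart) (f : M -> V) :=
  smooth_map atlas f /\
  forall phi, atlas phi -> forall u, tgt phi u ->
    injective ('d (f \o param phi) u : 'rV[R]_n -> V).

End Manifold.

Arguments chart : clear implicits.

Section Ambient.
Context {R : realType} {m : nat}.

(* The metric of R^m_q: the first q coordinates carry a minus sign. *)
Definition inner (q : nat) (v w : 'rV[R]_m) : R :=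
  \sum_(i < m) (-1) ^+ (i < q)%N * v 0 i * w 0 i.

(* Vectors are rows, so A v is written (A *m v^T)^T. *)
Definition mxapp (A : 'M[R]_m) (v : 'rV[R]_m) : 'rV[R]_m := (A *m v^T)^T.

Definition self_adjoint (q : nat) (A : 'M[R]_m) : Prop :=
  forall v w, inner q (mxapp A v) w = inner q v (mxapp A w).

End Ambient.

Section SpaceForms.
Context {R : realType} {n : nat}.
Implicit Types (a : 'rV[R]_n.+2) (tau r : R) (Sigma : set 'rV[R]_n.+2).

Definition sphere : set 'rV[R]_n.+2 := [set y | inner 0 y y = 1].

Definition hyperbolic : set 'rV[R]_n.+2 :=
  [set y | inner 1 y y = -1 /\ 0 < y 0 0].

Definition space_form (c : R) : set 'rV[R]_n.+2 :=
  if c == 1 then sphere else hyperbolic.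

Definition sphere_slice a tau := sphere `&` [set y | inner 0 a y = tau].

Definition hyperbolic_slice a tau := hyperbolic `&` [set y | inner 1 a y = tau].

Definition umbilical_sphere_in_sphere r Sigma : Prop :=
  exists a tau,
    [/\ inner 0 a a = 1, -1 < tau < 1, r = Num.sqrt (1 - tau ^+ 2)
      & Sigma = sphere_slice a tau].

Definition umbilical_hyperbolic_in_hyperbolic r Sigma : Prop :=
  exists a tau,
    [/\ inner 1 a a = 1, r = Num.sqrt (1 + tau ^+ 2),
        Sigma = hyperbolic_slice a tau & Sigma !=set0].

Definition umbilical_sphere_in_hyperbolic r Sigma : Prop :=
  exists a tau,
    [/\ inner 1 a a = -1, 1 < `|tau|, r = Num.sqrt (tau ^+ 2 - 1),
        Sigma = hyperbolic_slice a tau & Sigma !=set0].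

Definition umbilical_euclidean_in_hyperbolic Sigma : Prop :=
  exists a tau,
    [/\ a != 0, inner 1 a a = 0, tau != 0,
        Sigma = hyperbolic_slice a tau & Sigma !=set0].

Definition open_piece {M : Type} (x : M -> 'rV[R]_n.+2) Sigma : Prop :=
  exists2 U, open U & range x = Sigma `&` U.

End SpaceForms.

Section Algebra.
Context {R : realType} {n : nat}.

Definition elem_sym (k : nat) (kappa : 'rV[R]_n) : R :=
  \sum_(A : {set 'I_n} | #|A| == k) \prod_(i in A) kappa 0 i.

(* The eigenvalues of S, listed with multiplicity.  The default value 0 is
   taken only when the characteristic polynomial of S does not split over R,
   which cannot happen for a shape operator. *)
Definition eigenvalues (S : 'M[R]_n) : 'rV[R]_n :=
  xget 0 [set kappa : 'rV[R]_n |
            char_poly S = \prod_(i < n) ('X - (kappa 0 i)%:P)].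

Definition sym_curv (S : 'M[R]_n) (k : nat) : R := elem_sym k (eigenvalues S).

Fixpoint newton (S : 'M[R]_n) (k : nat) : 'M[R]_n :=
  if k is k'.+1 then (sym_curv S k)%:M - S *m newton S k' else 1%:M.

End Algebra.

(* Geometry of a parametrized hypersurface X : 'rV_n -> M_c in R^(n+2)_q with
   unit normal N, in the coordinates of the parameter domain.  The matrix T of
   an endomorphism of the tangent space in the coordinate basis has entries
   given by T(d_j) = \sum_i T i j d_i. *)
Section LocalGeometry.
Context {R : realType} {n : nat}.
Variables (c : R) (q : nat) (X N : 'rV[R]_n -> 'rV[R]_n.+2).
Implicit Types (u : 'rV[R]_n) (f : 'rV[R]_n -> R).

Definition induced_metric u : 'M[R]_n :=
  \matrix_(i, j) inner q (partial i X u) (partial j X u).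

Definition inv_metric u : 'M[R]_n := invmx (induced_metric u).

(* Christoffel symbols Gamma^l_ij of the induced metric. *)
Definition christoffel (l i j : 'I_n) u : R :=
  2^-1 * \sum_m inv_metric u l m *
    (partial i (fun v => induced_metric v j m) u
     + partial j (fun v => induced_metric v i m) u
     - partial m (fun v => induced_metric v i j) u).

Definition grad f (i : 'I_n) u : R := \sum_j inv_metric u i j * partial j f u.

(* The matrix of Y |-> nabla_Y (grad f), nabla the Levi-Civita connection of the
   induced metric. *)
Definition hessian f u : 'M[R]_n :=
  \matrix_(i, j) (partial j (grad f i) u
                  + \sum_m christoffel i j m u * grad f m u).

(* The coordinates in the basis (partial i X u)_i of a tangent vector w. *)
Definition tangent_coord u (w : 'rV[R]_n.+2) : 'cV[R]_n :=
  inv_metric u *m \col_i inner q (partial i X u) w.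

(* The Levi-Civita connection of M_c is the component tangent to M_c of the flat
   derivative; the normal direction of M_c at X u is X u itself, and
   <X u, X u> = c = c^-1. *)
Definition nabla_bar (Y : 'rV[R]_n -> 'rV[R]_n.+2) (j : 'I_n) u : 'rV[R]_n.+2 :=
  partial j Y u - (c * inner q (partial j Y u) (X u)) *: X u.

Definition shape_operator u : 'M[R]_n :=
  \matrix_(i, j) tangent_coord u (- nabla_bar N j u) i 0.

Definition mean_curvature (k : nat) u : R :=
  sym_curv (shape_operator u) k / 'C(n, k)%:R.

Definition linearized (k : nat) f u : R :=
  \tr (newton (shape_operator u) k *m hessian f u).

End LocalGeometry.

Section Hypersurface.
Context {R : realType} {n : nat} {M : topologicalType}.
Variables (c : R) (q : nat) (atlas : set (chart R n M)).
Variables (x N : M -> 'rV[R]_n.+2).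

Definition immersed_hypersurface : Prop :=
  immersion atlas x /\ forall p, space_form c (x p).

(* N is tangent to M_c, hence orthogonal to x, and normal to x(M).  Since M_c is
   orientable, such an N exists exactly when M is orientable. *)
Definition gauss_map : Prop :=
  [/\ smooth_map atlas N,
      forall p, inner q (N p) (N p) = 1,
      forall p, inner q (N p) (x p) = 0
    & forall phi, atlas phi -> forall u, tgt phi u ->
        forall v, inner q (N (param phi u)) ('d (x \o param phi) u v) = 0].

(* mean_curvature and linearized do not depend on the coordinates, so the values
   at p of H_k and L_k x may be computed in any chart around p. *)
Definition mean_curvature_at (phi : chart R n M) (k : nat) (p : M) : R :=
  mean_curvature c q (x \o param phi) (N \o param phi) k (coords phi p).

Definition linearized_at (phi : chart R n M) (k : nat) (f : M -> R) (p : M) : R :=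
  linearized c q (x \o param phi) (N \o param phi) k (f \o param phi) (coords phi p).

Definition constant_mean_curvature (k : nat) : Prop :=
  exists h : R, forall phi, atlas phi -> forall p, src phi p ->
    mean_curvature_at phi k p = h.

Definition linearized_position (phi : chart R n M) (k : nat) (p : M) :
    'rV[R]_n.+2 :=
  \row_j linearized_at phi k (fun p' => x p' 0 j) p.

End Hypersurface.

(* Main.v *)
Require Import Defs.
From HB Require Import structures.
From mathcomp Require Import all_boot all_order all_fingroup all_algebra.
From mathcomp Require Import all_classical all_reals all_analysis.
From mathcomp Require Import ring lra zify.
From mathcomp Require Import complex.

Set Implicit Arguments.
Unset Strict Implicit.
Unset Printing Implicit Defensive.

Import Order.TTheory GRing.Theory Num.Theory.
Import numFieldNormedType.Exports.

Local Open Scope classical_set_scope.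
Local Open Scope ring_scope.

(** The Gauss formula gives [L_k x = tr (S P_k) N - c tr (P_k) x], and
    [tr P_k = (n - k) s_k] is constant because [H_k] is.  If [L_k x = A x + b],
    put [B = A + c tr P_k], so that [B x + b = m N]; pairing with [x] gives
    [<B x, x> + <b, x> = 0], and differentiating this along [M], with [B]
    self-adjoint, shows that [b] is orthogonal to [dx].  Hence [<b, x> = tau] is
    constant and [M] lies in a slice.  Writing [b = beta N + c tau x] one gets
    [beta S = c tau I] and [beta ^ 2 = <b, b> - c tau ^ 2], which forces
    [beta <> 0]; if [tau = 0] then [S = 0] and [B x = - b], and applying the same
    identities to the constant vector [B b] leads to [<b, b> = 0], a
    contradiction.  Conversely, on a slice [S] is a constant multiple of the
    identity, nonzero since [tau <> 0], and [N] is an affine function of [x].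

    That [x (M)] is open in the slice is proved by minimizing
    [u |-> <x u - y, x u - y>] over a small coordinate ball for [y] in the slice
    close to [x u0]: at an interior critical point [y] lies in the plane of [x]
    and [N], which leaves only [y = x u] and one point far away. *)

(** * Newton transformations *)

Section NewtonTrace.
Context {R : comNzRingType} {n : nat}.

Lemma deriv_prod (I : finType) (F : I -> {poly R}) :
  (\prod_i F i)^`() = \sum_i (F i)^`() * \prod_(k | i != k) F k.
Proof.
suff H (s : seq I) : uniq s -> (\prod_(i <- s) F i)^`() =
    \sum_(i <- s) (F i)^`() * \prod_(k <- s | i != k) F k.
  by have := H _ (index_enum_uniq I).
elim: s => [|a s IH] /=; first by rewrite !big_nil derivC.
case/andP=> nas us; rewrite !big_cons derivM IH// eqxx/=; congr (_ * _ + _).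
  rewrite big_seq_cond [RHS]big_seq_cond; apply: eq_bigl => i /=.
  by rewrite andbT; case: (boolP (i \in s)) => //= si; apply/esym/eqP => e; rewrite e si in nas.
rewrite mulr_sumr big_seq [RHS]big_seq; apply: eq_bigr => i si.
rewrite big_cons; have -> : i != a by apply/eqP => e; rewrite -e si in nas.
by rewrite mulrCA.
Qed.

(** Jacobi's formula. In the permutation expansion only diagonal factors have a nonzero derivative,
    namely 1, and the permutations fixing [i] then expand the [i]-th diagonal cofactor. *)
Lemma deriv_char_poly (S : 'M[R]_n) :
  (char_poly S)^`() = \tr (\adj (char_poly_mx S)).
Proof.
rewrite /char_poly /determinant raddf_sum /=.
have deriv_sign (b : bool) (p : {poly R}) : ((-1) ^+ b * p)^`() = (-1) ^+ b * p^`().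
  by case: b; rewrite ?expr1 ?mulN1r ?derivN// !mul1r.
under eq_bigr => s _ do rewrite deriv_sign deriv_prod mulr_sumr.
rewrite exchange_big /=; apply: eq_bigr => i _.
rewrite mxE expand_cofactor [RHS]big_mkcond /=; apply: eq_bigr => s _.
rewrite !mxE derivB derivMn derivX derivC subr0 eq_sym.
by case: eqP => _; rewrite ?mul1r// mulr0n mul0r mulr0.
Qed.

(** Vieta's formula: expanding the product chooses a subset of factors contributing their root, and
    the subsets of size [k] give degree [n - k]. *)
Lemma coef_prod_XsubC (kappa : 'rV[R]_n) (k : nat) : (k <= n)%N ->
  (\prod_(i < n) ('X - (kappa 0 i)%:P))`_(n - k) =
  (-1) ^+ k * \sum_(A : {set 'I_n} | #|A| == k) \prod_(i in A) kappa 0 i.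
Proof.
move=> kn.
under eq_bigr do rewrite addrC.
rewrite bigA_distr coef_sum mulr_sumr [RHS]big_mkcond /=; apply: eq_bigr => J _.
rewrite (bigID (mem J)) /=.
rewrite (eq_bigr (fun i => (- kappa 0 i)%:P)); last by move=> i ->; rewrite polyCN.
rewrite [X in _ * X](eq_bigr (fun=> 'X)); last by move=> i /negbTE ->.
rewrite prodr_const -rmorph_prod /= coefCM coefXn prodrN.
rewrite [X in (_ == X)%N](_ : _ = (n - #|J|)%N); last first.
  have := cardsC J; rewrite card_ord => nJ; apply/eqP; rewrite -(eqn_add2l #|J|) subnKC; last first.
    by rewrite -[leqRHS]card_ord max_card.
  rewrite -[eqbRHS]nJ eqn_add2l; apply/eqP.
  by apply: eq_card => i; rewrite !inE.
have Jn : (#|J| <= n)%N by rewrite -[leqRHS]card_ord max_card.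
rewrite (_ : (n - k == n - #|J|)%N = (#|J| == k)).
  by case: eqP => [->|]; rewrite ?mulr1 ?mulr0.
by apply/eqP/eqP; lia.
Qed.

End NewtonTrace.

Section Newton.
Context {R : realType} {n : nat}.
Implicit Types (S : 'M[R]_n) (kappa : 'rV[R]_n).

Lemma eigenvalues_split S :
  (exists kappa : 'rV[R]_n, char_poly S = \prod_(i < n) ('X - (kappa 0 i)%:P)) ->
  char_poly S = \prod_(i < n) ('X - (eigenvalues S 0 i)%:P).
Proof.
by move=> [kappa hkappa]; exact: (@xgetPex _ 0 [set k : 'rV[R]_n | _] (ex_intro _ kappa hkappa)).
Qed.

Lemma coef_char_poly_split S k :
  char_poly S = \prod_(i < n) ('X - (eigenvalues S 0 i)%:P) -> (k <= n)%N ->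
  (char_poly S)`_(n - k) = (-1) ^+ k * sym_curv S k.
Proof. by move=> -> kn; rewrite coef_prod_XsubC. Qed.

(** Coefficient of degree [j + 1] in the identity of ['X - S] times its adjugate with [char_poly S]
    times the identity. *)
Lemma adj_char_poly_rec S (j : nat) :
  map_mx (coefp j) (\adj (char_poly_mx S)) =
  ((char_poly S)`_j.+1)%:M + S *m map_mx (coefp j.+1) (\adj (char_poly_mx S)).
Proof.
have /matrixP H := mul_mx_adj (char_poly_mx S).
apply/matrixP => a b; have := congr1 (coefp j.+1) (H a b).
rewrite /= !mxE coef_sum.
under eq_bigr => i _ do rewrite !mxE mulrBl coefB coefCM mulrnAl coefMn coefXM /=.
rewrite big_split /= sumrN.
rewrite (bigD1 a) //= big1 ?addr0 ?eqxx; last first.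
  by move=> i /negbTE; rewrite eq_sym => ->; rewrite mulr0n.
rewrite mulr1n -/(char_poly S) coefMn => /eqP; rewrite subr_eq => /eqP ->; congr (_ + _).
by apply: eq_bigr => i _; rewrite !mxE.
Qed.

(** Descending induction: the coefficients vanish beyond the largest entry size, and the recursion
    carries this down to [n] because [char_poly S] has degree [n]. *)
Lemma adj_char_poly_high S (j : nat) : (n <= j)%N ->
  map_mx (coefp j) (\adj (char_poly_mx S)) = 0.
Proof.
pose N := \max_(ab : 'I_n * 'I_n) size (\adj (char_poly_mx S) ab.1 ab.2).
have big m : (N <= m)%N -> map_mx (coefp m) (\adj (char_poly_mx S)) = 0.
  move=> Nm; apply/matrixP => a b; rewrite !mxE /= nth_default//.
  apply: leq_trans Nm; have := @leq_bigmax _ (fun ab : 'I_n * 'I_n => size (\adj (char_poly_mx S) ab.1 ab.2)) (a, b).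
  by rewrite /= !mxE.
move=> nj; have [d] : exists d, (N <= j + d)%N by exists N; exact: leq_addl.
elim: d j nj => [|d IH] j nj; first by rewrite addn0; exact: big.
rewrite addnS -addSn => /(IH _ (leqW nj)) H.
by rewrite adj_char_poly_rec H mulmx0 addr0 nth_default ?size_char_poly// raddf0.
Qed.

(* The coefficients of [\adj ('X - S)] obey the same recursion as the Newton
   transformations. *)
Lemma adj_char_poly_newton S k :
  char_poly S = \prod_(i < n) ('X - (eigenvalues S 0 i)%:P) -> (k < n)%N ->
  map_mx (coefp (n - k.+1)) (\adj (char_poly_mx S)) = (-1) ^+ k *: newton S k.
Proof.
move=> split; elim: k => [|k IH] kn; rewrite adj_char_poly_rec -subSn ?subSS//.
  rewrite subn0 adj_char_poly_high// mulmx0 addr0 expr0 scale1r /=.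
  have /monicP := char_poly_monic S.
  by rewrite /lead_coef size_char_poly /= => ->.
rewrite IH ?(ltnW kn)// coef_char_poly_split ?(ltnW kn)// /=.
by rewrite scalerBr scale_scalar_mx -scalemxAr exprS mulN1r !scaleNr opprK.
Qed.

(* The Cayley-Hamilton theorem. *)
Lemma newton_full S :
  char_poly S = \prod_(i < n) ('X - (eigenvalues S 0 i)%:P) -> (0 < n)%N ->
  newton S n = 0.
Proof.
move=> split n0.
have H : ((char_poly S)`_0)%:M + S *m map_mx (coefp 0) (\adj (char_poly_mx S)) = 0.
  have /matrixP H := mul_mx_adj (char_poly_mx S).
  apply/matrixP => a b; have := congr1 (coefp 0) (H a b).
  rewrite /= !mxE coef_sum.
  under eq_bigr => i _ do rewrite !mxE mulrBl coefB coefCM mulrnAl coefMn coefXM /= mul0rn sub0r.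
  rewrite sumrN -/(char_poly S) coefMn => <-; rewrite addrC; apply/eqP; rewrite subr_eq0; apply/eqP.
  by apply: eq_bigr => i _; rewrite !mxE.
move: H; have := @adj_char_poly_newton S n.-1 split; rewrite prednK// subnn => ->//.
have := coef_char_poly_split split (leqnn n); rewrite subnn => ->.
have newtonS k : (0 < k)%N -> newton S k = (sym_curv S k)%:M - S *m newton S k.-1 by case: k.
have signS k : (0 < k)%N -> (-1) ^+ k = - (-1) ^+ k.-1 :> R.
  by case: k => // k _; rewrite exprS mulN1r.
rewrite (newtonS n)// (signS n)// mulNr raddfN /= -scale_scalar_mx -scalemxAr addrC -scalerBr.
move=> /eqP; rewrite scaler_eq0 expf_eq0 oppr_eq0 oner_eq0 andbF/= => /eqP HH.
by rewrite -opprB HH oppr0.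
Qed.

(** Coefficient of degree [n - k - 1] in Jacobi's formula; differentiation contributes the factor
    [n - k]. The case [k = n] falls outside this range and rests on Cayley-Hamilton, or on an empty
    trace if [n = 0]. *)
Lemma trace_newton S k :
  (exists kappa : 'rV[R]_n, char_poly S = \prod_(i < n) ('X - (kappa 0 i)%:P)) ->
  (k <= n)%N -> \tr (newton S k) = (n - k)%:R * sym_curv S k.
Proof.
move=> /eigenvalues_split split; rewrite leq_eqVlt => /predU1P[->|kn].
  rewrite subnn mul0r.
  have [n0|n0] := posnP n; last by rewrite newton_full// raddf0.
  by rewrite /mxtrace big1// => i; have := ltn_ord i; rewrite [X in (_ < X)%N]n0.
have := congr1 (fun p : {poly R} => p`_(n - k.+1)) (deriv_char_poly S).
rewrite coef_deriv -subSn// subSS coef_char_poly_split ?(ltnW kn)//.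
rewrite [X in _ = X -> _](_ : _ = \tr (map_mx (coefp (n - k.+1)) (\adj (char_poly_mx S)))); last first.
  by rewrite /mxtrace coef_sum; apply: eq_bigr => i _; rewrite !mxE.
rewrite adj_char_poly_newton// mxtraceZ -mulrnAr => /mulrI <-//.
  by rewrite mulr_natl.
by rewrite unitrX// unitrN1.
Qed.

(** Trace of the recursion defining [newton S k.+1], with [trace_newton] substituted. *)
Lemma trace_mul_newton S k :
  (exists kappa : 'rV[R]_n, char_poly S = \prod_(i < n) ('X - (kappa 0 i)%:P)) ->
  (k < n)%N -> \tr (S *m newton S k) = k.+1%:R * sym_curv S k.+1.
Proof.
move=> split kn; have := trace_newton split kn; rewrite /= raddfB /= mxtrace_scalar => /eqP.
rewrite subr_eq addrC -subr_eq => /eqP <-.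
by rewrite natrB// -[_ *+ n]mulr_natl mulrBl opprB addrC subrK.
Qed.

Lemma sym_curv_scalar (lambda : R) k : sym_curv (lambda%:M : 'M[R]_n) k = 'C(n, k)%:R * lambda ^+ k.
Proof.
have split : char_poly (lambda%:M : 'M[R]_n) = \prod_(i < n) ('X - lambda%:P).
  rewrite char_poly_trig ?scalar_mx_is_trig//.
  by apply: eq_bigr => i _; rewrite mxE eqxx mulr1n.
have /eigenvalues_split H : exists kappa : 'rV[R]_n,
    char_poly (lambda%:M : 'M[R]_n) = \prod_(i < n) ('X - (kappa 0 i)%:P).
  by exists (const_mx lambda); rewrite split; apply: eq_bigr => i _; rewrite mxE.
(* [eigenvalues] is only some list splitting the polynomial, but each entry is a root of the [n]-th
   power of ['X - lambda]. *)
have ev i : eigenvalues (lambda%:M : 'M[R]_n) 0 i = lambda.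
  have := congr1 (horner^~ (eigenvalues (lambda%:M : 'M[R]_n) 0 i)) H.
  rewrite /= split !horner_prod [RHS](bigD1 i)//= !hornerE subrr mul0r => /eqP.
  by rewrite prodf_seq_eq0 => /hasP[j _ /=]; rewrite subr_eq0 => /eqP.
rewrite /sym_curv /elem_sym.
under eq_bigr => A /eqP hA do (under eq_bigr do rewrite ev; rewrite prodr_const hA).
by rewrite sumr_const -[X in 'C(X, _)]card_ord -card_draws mulr_natl; congr (_ *+ _); apply: eq_card => A; rewrite inE.
Qed.

End Newton.

(** * Real spectrum of a self-adjoint endomorphism *)

Section SelfAdjointSplit.
Context {R : realType} {n : nat}.

Lemma char_poly_trmx (S : 'M[R]_n) : char_poly S^T = char_poly S.
Proof.
rewrite /char_poly -[RHS]det_tr; congr (\det _).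
by apply/matrixP => i j; rewrite !mxE eq_sym.
Qed.

(** Over the complex numbers, an eigenvector [p + i q] with eigenvalue [z] satisfies
    [Im z (g(p, p) + g(q, q)) = 0], and positivity of [g] makes every root real. *)
Lemma char_poly_self_adjoint (g S : 'M[R]_n) :
  (forall v : 'rV[R]_n, v != 0 -> 0 < (v *m g *m v^T) 0 0) ->
  g^T = g -> (g *m S)^T = g *m S ->
  exists kappa : 'rV[R]_n, char_poly S = \prod_(i < n) ('X - (kappa 0 i)%:P).
Proof.
move=> gpos gsym gS.
pose f := real_complex R.
have [r hr] := closed_field_poly_normal (map_poly f (char_poly S^T)).
move: hr; rewrite (monicP _) ?map_monic ?char_poly_monic// scale1r => hr.
have zreal z : z \in r -> complex.Im z = 0.
  move=> zr.
  have : root (char_poly (map_mx f S^T)) z.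
    by rewrite -map_char_poly hr root_prod_XsubC.
  rewrite -eigenvalue_root_char => /eigenvalueP[v hv v0].
  pose p := map_mx (@complex.Re R) v; pose q := map_mx (@complex.Im R) v.
  have vE i : v 0 i = Complex (p 0 i) (q 0 i) by rewrite !mxE; case: (v 0 i).
  have HS i : (v *m map_mx f S^T) 0 i = Complex ((p *m S^T) 0 i) ((q *m S^T) 0 i).
    rewrite !mxE; under eq_bigr => j _ do rewrite !mxE vE.
    rewrite (eq_bigr (fun j => Complex (p 0 j * S i j) (q 0 j * S i j))); last first.
      by move=> j _; rewrite /f /= /GRing.mul /= !mulr0 subr0 add0r.
    by elim/big_rec3: _ => // j x y w _ ->; rewrite !mxE.
  have ReM (a b : R[i]) : complex.Re (a * b) =
      complex.Re a * complex.Re b - complex.Im a * complex.Im b by case: a; case: b.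
  have ImM (a b : R[i]) : complex.Im (a * b) =
      complex.Re a * complex.Im b + complex.Im a * complex.Re b by case: a; case: b.
  have hp : p *m S^T = complex.Re z *: p - complex.Im z *: q.
    apply/rowP => i; have := congr1 (fun w : 'rV_n => complex.Re (w 0 i)) hv.
    by rewrite HS /= !mxE => ->; rewrite ReM.
  have hq : q *m S^T = complex.Im z *: p + complex.Re z *: q.
    apply/rowP => i; have := congr1 (fun w : 'rV_n => complex.Im (w 0 i)) hv.
    by rewrite HS /= !mxE => ->; rewrite ImM addrC.
  have tr1 (a : 'M[R]_1) : a^T = a by apply/matrixP => i j; rewrite mxE (ord1 i) (ord1 j).
  (* Self-adjointness for the pair [p], [q]; substituting [hp] and [hq] leaves [Im z] times the sum
     of the two squares. *)
  have hsym : p *m S^T *m g *m q^T = (q *m S^T *m g *m p^T).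
    rewrite -[LHS]tr1 !trmx_mul !trmxK gsym !mulmxA.
    by rewrite -[q *m g *m S]mulmxA -gS trmx_mul gsym mulmxA.
  have gpq : p *m g *m q^T = q *m g *m p^T.
    by rewrite -[LHS]tr1 !trmx_mul !trmxK gsym mulmxA.
  set x := (q *m g *m q^T) 0 0; set y := (p *m g *m p^T) 0 0.
  have : complex.Im z * (y + x) = 0.
    rewrite /x /y; move: hsym; rewrite hp hq !(mulmxBl, mulmxDl) -!scalemxAl gpq.
    move: (q *m g *m p^T) (q *m g *m q^T) (p *m g *m p^T) => B C D /matrixP/(_ 0 0).
    by rewrite !mxE; lra.
  move/eqP; rewrite mulf_eq0 => /orP[/eqP//|/eqP yx].
  have ge0 (w : 'rV[R]_n) : 0 <= (w *m g *m w^T) 0 0.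
    by have [->|w0] := eqVneq w 0; [rewrite !mul0mx mxE|exact/ltW/gpos].
  have [p0|/(gpos _) pp] := eqVneq p 0; last by have := ge0 q; rewrite -/x; move: pp; rewrite -/y; lra.
  have [q0|/(gpos _) qp] := eqVneq q 0; last by have := ge0 p; rewrite -/y; move: qp; rewrite -/x; lra.
  case/eqP: v0; apply/rowP => i; rewrite vE p0 q0 !mxE.
  by [].
have size_r : size r = n.
  have := congr1 (fun p : {poly R[i]} => size p) hr.
  by rewrite /= size_map_poly size_char_poly size_prod_XsubC => -[].
exists (\row_i complex.Re r`_i).
rewrite -char_poly_trmx; apply: (map_poly_inj f); rewrite hr rmorph_prod /= (big_nth 0) big_mkord size_r.
apply: eq_bigr => i _; rewrite mxE rmorphB /= map_polyX map_polyC /=.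
congr (_ - _%:P); have := zreal r`_i (mem_nth 0 _); rewrite size_r ltn_ord => /(_ isT).
by case: r`_i => a b /= ->.
Qed.

End SelfAdjointSplit.

(** * Differential calculus *)

Section Calculus.
Context {R : realType} {V : normedModType R}.
Implicit Types (u v w : V).

Lemma is_derive_coord m (f : V -> 'rV[R]_m) u v df j :
  is_derive u v f df -> is_derive u v (fun z => f z 0 j) (df 0 j).
Proof.
move=> [fu <-]; apply: DeriveDef; first by have /derivable_mxP := fu; apply.
by rewrite derive_mx// mxE.
Qed.

Lemma is_derive_row m (f : V -> 'rV[R]_m) u v (df : 'rV[R]_m) :
  (forall j, is_derive u v (fun z => f z 0 j) (df 0 j)) -> is_derive u v f df.
Proof.
move=> H; have fu : derivable f u v.
  by apply/derivable_mxP => i j; rewrite (ord1 i).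
by apply: DeriveDef => //; rewrite derive_mx//; apply/rowP => j; rewrite mxE derive_val.
Qed.

Lemma is_derive_sum_fct n (h : 'I_n -> V -> R) u v (dh : 'I_n -> R) :
  (forall i, is_derive u v (h i) (dh i)) ->
  is_derive u v (fun z => \sum_(i < n) h i z) (\sum_(i < n) dh i).
Proof.
move=> H; have -> : (fun z => \sum_(i < n) h i z) = \sum_(i < n) h i.
  by apply/funext => z; rewrite fct_sumE.
exact: is_derive_sum.
Qed.

Lemma is_derive_mul (f g : V -> R) u v df dg :
  is_derive u v f df -> is_derive u v g dg ->
  is_derive u v (fun z => f z * g z) (df * g u + f u * dg).
Proof.
move=> hf hg; apply: (is_derive_eq (is_deriveM hf hg)).
by rewrite addrC; congr (_ + _); exact: mulrC.
Qed.

Lemma is_derive_inner m q (f g : V -> 'rV[R]_m) u v df dg :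
  is_derive u v f df -> is_derive u v g dg ->
  is_derive u v (fun z => inner q (f z) (g z)) (inner q df (g u) + inner q (f u) dg).
Proof.
move=> hf hg; rewrite /inner -big_split /=; apply: is_derive_sum_fct => i.
have H1 := is_derive_mul (is_derive_cst ((-1) ^+ (i < q)%N : R) u v) (is_derive_coord i hf).
apply: (is_derive_eq (is_derive_mul H1 (is_derive_coord i hg))).
by rewrite mul0r add0r.
Qed.

Lemma derivable_prod_fct (I : Type) (s : seq I) (P : pred I) (h : I -> V -> R) u v :
  (forall i, derivable (h i) u v) ->
  derivable (fun z => \prod_(i <- s | P i) h i z) u v.
Proof.
move=> H; elim: s => [|a s IH].
  have -> : (fun z => \prod_(i <- [::] | P i) h i z) = cst 1.
    by apply/funext => z; rewrite big_nil.
  exact: derivable_cst.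
case Pa : (P a); last first.
  rewrite (_ : (fun z => _) = (fun z => \prod_(i <- s | P i) h i z))//.
  by apply/funext => z; rewrite big_cons Pa.
rewrite (_ : (fun z => _) = h a * (fun z => \prod_(i <- s | P i) h i z)).
  exact: derivableM.
by apply/funext => z; rewrite big_cons Pa.
Qed.

Lemma derivable_sum_fct (I : Type) (s : seq I) (P : pred I) (h : I -> V -> R) u v :
  (forall i, derivable (h i) u v) ->
  derivable (fun z => \sum_(i <- s | P i) h i z) u v.
Proof.
move=> H; elim: s => [|a s IH].
  have -> : (fun z => \sum_(i <- [::] | P i) h i z) = cst 0.
    by apply/funext => z; rewrite big_nil.
  exact: derivable_cst.
case Pa : (P a); last first.
  rewrite (_ : (fun z => _) = (fun z => \sum_(i <- s | P i) h i z))//.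
  by apply/funext => z; rewrite big_cons Pa.
rewrite (_ : (fun z => _) = h a + (fun z => \sum_(i <- s | P i) h i z)).
  exact: derivableD.
by apply/funext => z; rewrite big_cons Pa.
Qed.

Lemma derivable_det n (M : V -> 'M[R]_n) u v :
  (forall i j, derivable (fun z => M z i j) u v) -> derivable (fun z => \det (M z)) u v.
Proof.
move=> H; apply: derivable_sum_fct => s.
rewrite (_ : (fun z => _) = (fun z => cst ((-1) ^+ s) z * (\prod_i M z i (s i)))) //.
by apply: derivableM; [exact: derivable_cst|exact: derivable_prod_fct].
Qed.

(** Cramer's rule: near [u] the entries of the inverse are cofactors divided by the determinant. *)
Lemma derivable_invmx n (M : V -> 'M[R]_n) u v :
  (forall i j, derivable (fun z => M z i j) u v) ->
  (\forall z \near u, M z \in unitmx) ->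
  forall i j, derivable (fun z => invmx (M z) i j) u v.
Proof.
move=> H nu i j.
apply: (@near_eq_derivable _ _ _ (fun z => (\det (M z))^-1 * \adj (M z) i j)).
  by near=> z; rewrite /invmx (near nu z) ?mxE.
apply: derivableM.
  apply: derivableV; last exact: derivable_det.
  by have := nbhs_singleton nu; rewrite unitmxE unitfE.
rewrite (_ : (fun z => _) = (fun z => cst ((-1) ^+ (j + i)) z * \det (row' j (col' i (M z))))).
  apply: derivableM; first exact: derivable_cst.
  apply: derivable_det => a b.
  by rewrite (_ : (fun z => _) = (fun z => M z (lift j a) (lift i b)))//; apply/funext => z; rewrite !mxE.
by apply/funext => z; rewrite mxE.
Unshelve. all: by end_near. Qed.

Lemma is_derive_line (f : V -> R) a v (s df : R) : is_derive (s *: v + a) v f df ->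
  is_derive s 1 (fun t => f (t *: v + a)) df.
Proof.
move=> [fd <-]; have E : (fun h : R => h^-1 *: ((f \o shift (s *: v + a)) (h *: v) - f (s *: v + a))) =
    (fun h => h^-1 *: (((fun t => f (t *: v + a)) \o shift s) (h *: 1) - f (s *: v + a))).
  by apply/funext => h /=; rewrite addrA -scalerDl [h *: 1]mulr1.
apply: DeriveDef; first by move: fd; rewrite /derivable E.
by rewrite /derive E.
Qed.

Lemma segment_cst (f : V -> R) a b :
  (forall t : R, 0 <= t <= 1 -> differentiable f (t *: (b - a) + a)) ->
  (forall t : R, 0 <= t <= 1 -> 'D_(b - a) f (t *: (b - a) + a) = 0) ->
  f b = f a.
Proof.
move=> fd f0; set g := fun t : R => f (t *: (b - a) + a).
have gd (t : R) : 0 <= t <= 1 -> is_derive t 1 g 0.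
  move=> t01; apply: (is_derive_eq _ (f0 _ t01)).
  by apply/is_derive_line/DeriveDef => //; apply: diff_derivable; exact: fd.
have [t ht|//|t _] := @MVT_segment R g (fun=> 0) 0 1 ler01.
- by apply: gd; move: ht; rewrite in_itv /= => /andP[/ltW -> /ltW ->].
- apply: derivable_within_continuous => t; rewrite in_itv /= => /gd ht.
  exact: ex_derive.
- by rewrite mul0r /g scale1r scale0r add0r subrK => /eqP; rewrite subr_eq0 => /eqP.
Qed.

(** The little-o remainder as an explicit bound, the form used for Young's theorem and for local
    injectivity. *)
Lemma differentiable_eps (W : normedModType R) (f : V -> W) u : differentiable f u ->
  forall e : R, 0 < e ->
    \forall z \near (0 : V), `|f (z + u) - f u - 'd f u z| <= e * `|z|.
Proof.
move=> /diff_locally; set k := 'o _ => E e e0.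
have /(littleoP [littleo of k]) H : 0 < e by [].
apply: filterS H => z; apply: le_trans.
have -> : f (z + u) = f u + 'd f u z + k z := congr1 (fun h => h z) E.
by rewrite -[X in `|X|]addrA -opprD [f u + _ + _]addrC addrK.
Qed.

Let second_difference (f : V -> R) u v w (h : R) :=
  f (h *: v + (h *: w + u)) - f (h *: v + u) - (f (h *: w + u) - f u).

(** The mean value theorem in direction [v] turns the second difference into [h] times
    [F (c v + h w + u) - F (c v + u)]. Expanding both values of [F] to first order at [u], the terms
    along [c v] cancel. *)
Lemma second_difference_approx (f F : V -> R) u v w :
  (\forall z \near u, is_derive z v f (F z)) -> differentiable F u ->
  forall e : R, 0 < e -> \forall h \near 0^'+,
    `|second_difference f u v w h - h ^+ 2 * 'D_w F u| <= e * h ^+ 2.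
Proof.
move=> nf Fd e e0.
(* [h * K] bounds the sum of the norms of the displacements [c v + h w] and [c v]; the extra 1 makes
   the radius conditions strict. *)
pose K := `|v| + `|v| + `|w| + 1.
have K0 : 0 < K by rewrite ltr_wpDl// !addr_ge0.
have eK : 0 < e / K by rewrite divr_gt0.
have /nbhs_norm0P[d1 /= d10 H1] := differentiable_eps Fd eK.
have /nbhs_norm0P[d2 /= d20 H2] : \forall z \near (0 : V), is_derive (z + u) v f (F (z + u)).
  by have := nf; rewrite (near_shift (0 : V)) /= subr0.
near=> h.
have h0 : 0 < h by [].
have hK1 : h * K < d1 by rewrite -ltr_pdivlMr//; near: h; apply: nbhs_right_lt; rewrite divr_gt0.
have hK2 : h * K < d2 by rewrite -ltr_pdivlMr//; near: h; apply: nbhs_right_lt; rewrite divr_gt0.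
have n1 (t : R) : 0 <= t <= h -> `|t *: v| <= h * `|v|.
  by move=> /andP[t0 th]; rewrite normrZ ger0_norm// ler_wpM2r.
have nw : `|h *: w| = h * `|w| by rewrite normrZ gtr0_norm.
have n2 (t : R) : 0 <= t <= h -> `|t *: v + h *: w| <= h * (`|v| + `|w|).
  by move=> th; rewrite (le_trans (ler_normD _ _))// mulrDr nw lerD2r n1.
have lt1 : h * `|v| < h * K by rewrite ltr_pM2l// /K -!addrA ltrDl !addrA ltr_wpDl// addr_ge0.
have lt2 : h * (`|v| + `|w|) < h * K.
  by rewrite ltr_pM2l// /K -!addrA ltrD2l ltr_wpDl// ltrDl.
have dd1 (t : R) : 0 <= t <= h -> is_derive (t *: v + u) v f (F (t *: v + u)).
  by move=> th; apply: (H2 (t *: v)); rewrite /= (le_lt_trans (n1 _ th))// (lt_trans lt1).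
have dd2 (t : R) : 0 <= t <= h -> is_derive (t *: v + (h *: w + u)) v f (F (t *: v + (h *: w + u))).
  by move=> th; rewrite addrA; apply: (H2 (t *: v + h *: w)); rewrite /= (le_lt_trans (n2 _ th))// (lt_trans lt2).
pose psi (t : R) := f (t *: v + (h *: w + u)) - f (t *: v + u).
have dpsi (t : R) : 0 <= t <= h ->
    is_derive t 1 psi (F (t *: v + (h *: w + u)) - F (t *: v + u)).
  by move=> th; apply: is_deriveB; apply: is_derive_line; [exact: dd2|exact: dd1].
have [t /[!in_itv]/=/andP[t0 th]|//|c] := @MVT_segment R psi (fun t => F (t *: v + (h *: w + u)) - F (t *: v + u)) 0 h (ltW h0).
- by apply: dpsi; rewrite !ltW.
- apply: derivable_within_continuous => t; rewrite in_itv /= => /dpsi ht.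
  exact: ex_derive.
rewrite in_itv/= => ch; rewrite subr0 => psiE.
have -> : second_difference f u v w h = (F (c *: v + (h *: w + u)) - F (c *: v + u)) * h.
  by rewrite -psiE /psi /second_difference scale0r !add0r.
have E1 := H1 _ (le_lt_trans (n2 _ ch) (lt_trans lt2 hK1)).
have E2 := H1 _ (le_lt_trans (n1 _ ch) (lt_trans lt1 hK1)).
rewrite deriveE//; have wE : 'd F u (c *: v + h *: w) = 'd F u (c *: v) + h * 'd F u w.
  by rewrite linearD; congr (_ + _); rewrite linearZ.
move: E1; rewrite /= wE -(addrA _ _ u) => E1.
rewrite (_ : _ - _ = ((F (c *: v + (h *: w + u)) - F u - ('d F u (c *: v) + h * 'd F u w))
   - (F (c *: v + u) - F u - 'd F u (c *: v))) * h); last by ring.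
rewrite normrM [`|h|]gtr0_norm// expr2 mulrA; apply: ler_wpM2r; first exact: ltW.
rewrite (le_trans (ler_normB _ _))//.
have -> : e * h = e / K * (h * K) by field; rewrite gt_eqF.
apply: le_trans (lerD E1 E2) _; rewrite -mulrDr; apply: ler_wpM2l; first exact: ltW.
apply: le_trans (lerD (n2 _ ch) (n1 _ ch)) _.
rewrite -mulrDr; apply: ler_wpM2l; first exact: ltW.
by rewrite /K addrAC lerDl.
Unshelve. all: by end_near. Qed.

(* Young's theorem: both sides are limits of the second difference over [h ^+ 2]. *)
Lemma derive_comm (f F G : V -> R) u v w :
  (\forall z \near u, is_derive z v f (F z)) -> (\forall z \near u, is_derive z w f (G z)) ->
  differentiable F u -> differentiable G u -> 'D_w F u = 'D_v G u.
Proof.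
move=> nv nw dv dw; apply/eqP; rewrite -subr_eq0 -normr_le0; apply/ler_addgt0Pr => e e0.
rewrite add0r.
have e2 : 0 < e / 2 by rewrite divr_gt0.
near (0:R)^'+ => h.
have h0 : 0 < h by [].
have h20 : 0 < h ^+ 2 by rewrite exprn_gt0.
have A : `|second_difference f u v w h - h ^+ 2 * 'D_w F u| <= e / 2 * h ^+ 2.
  by near: h; exact: second_difference_approx.
have B : `|second_difference f u w v h - h ^+ 2 * 'D_v G u| <= e / 2 * h ^+ 2.
  by near: h; exact: second_difference_approx.
have sym : second_difference f u w v h = second_difference f u v w h.
  by rewrite /second_difference addrCA opprB !addrA; ring.
rewrite sym in B.
rewrite -(ler_pM2r h20) -{1}(gtr0_norm h20) -normrM.
have -> : ('D_w F u - 'D_v G u) * h ^+ 2 =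
   (second_difference f u v w h - h ^+ 2 * 'D_v G u) -
   (second_difference f u v w h - h ^+ 2 * 'D_w F u) by ring.
rewrite (le_trans (ler_normB _ _))// (le_trans (lerD B A))//.
by rewrite -mulrDl -splitr.
Unshelve. all: by end_near. Qed.

End Calculus.

(** * The ambient metric *)

Section Inner.
Context {R : realType} {m : nat}.
Variable q : nat.
Implicit Types (u v w : 'rV[R]_m) (a : R).

Lemma innerC v w : inner q v w = inner q w v.
Proof. by apply: eq_bigr => i _; rewrite mulrAC. Qed.

Lemma innerDl u v w : inner q (u + v) w = inner q u w + inner q v w.
Proof. by rewrite /inner -big_split /=; apply: eq_bigr => i _; rewrite mxE mulrDr mulrDl. Qed.

Lemma innerZl a v w : inner q (a *: v) w = a * inner q v w.
Proof. by rewrite /inner mulr_sumr; apply: eq_bigr => i _; rewrite mxE !mulrA [_ * a]mulrC. Qed.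

Lemma innerDr u v w : inner q w (u + v) = inner q w u + inner q w v.
Proof. by rewrite innerC innerDl !(innerC w). Qed.

Lemma innerZr a v w : inner q w (a *: v) = a * inner q w v.
Proof. by rewrite innerC innerZl (innerC w). Qed.

Lemma innerNl v w : inner q (- v) w = - inner q v w.
Proof. by rewrite -scaleN1r innerZl mulN1r. Qed.

Lemma innerNr v w : inner q w (- v) = - inner q w v.
Proof. by rewrite innerC innerNl (innerC w). Qed.

Lemma innerBl u v w : inner q (u - v) w = inner q u w - inner q v w.
Proof. by rewrite innerDl innerNl. Qed.

Lemma innerBr u v w : inner q w (u - v) = inner q w u - inner q w v.
Proof. by rewrite innerDr innerNr. Qed.

Lemma inner0l w : inner q 0 w = 0.
Proof. by rewrite -(scale0r (0 : 'rV[R]_m)) innerZl mul0r. Qed.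

Lemma inner0r w : inner q w 0 = 0.
Proof. by rewrite innerC inner0l. Qed.

Lemma inner_suml (I : Type) (s : seq I) (P : pred I) (F : I -> 'rV[R]_m) w :
  inner q (\sum_(i <- s | P i) F i) w = \sum_(i <- s | P i) inner q (F i) w.
Proof.
by elim/big_rec2: _ => [|i x y _ <-]; rewrite ?inner0l// innerDl.
Qed.

(** The Gram matrix of [inner q], through which orthogonality becomes a matrix equation. *)
Definition signature_mx : 'M[R]_m := \matrix_(i, j) ((-1) ^+ (i < q)%N *+ (i == j)).

Lemma inner_mxE v w : inner q v w = (v *m signature_mx *m w^T) 0 0.
Proof.
rewrite mxE; apply: eq_bigr => i _; rewrite !mxE (bigD1 i)//= big1 ?addr0; last first.
  by move=> j /negbTE ji; rewrite !mxE ji mulr0.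
by rewrite !mxE eqxx mulr1n [v 0 i * _]mulrC.
Qed.

Lemma signature_mx_unit : signature_mx \in unitmx.
Proof.
suff H : signature_mx *m signature_mx = 1%:M by case/mulmx1_unit: H.
apply/matrixP => i j; rewrite !mxE (bigD1 i)//= big1 ?addr0; last first.
  by move=> k /negbTE ki; rewrite !mxE eq_sym ki mul0r.
rewrite !mxE eqxx mulr1n; case: eqP => _; rewrite ?mulr0n ?mulr0// mulr1n.
by rewrite -expr2 sqrr_sign.
Qed.

End Inner.

(** * Cauchy-Schwarz and spacelike vectors *)

Section Causality.
Context {R : realType}.

(** Lagrange's identity: a double sum of squares equals twice the gap. *)
Lemma sum_CauchySchwarz n (a b : 'I_n -> R) :
  (\sum_i a i * b i) ^+ 2 <= (\sum_i a i ^+ 2) * (\sum_i b i ^+ 2).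
Proof.
have : 0 <= \sum_i \sum_j (a i * b j - a j * b i) ^+ 2.
  by apply: sumr_ge0 => i _; apply: sumr_ge0 => j _; exact: sqr_ge0.
have -> : \sum_i \sum_j (a i * b j - a j * b i) ^+ 2 =
    2 * ((\sum_i a i ^+ 2) * (\sum_i b i ^+ 2) - (\sum_i a i * b i) ^+ 2).
  have E i j : (a i * b j - a j * b i) ^+ 2 =
      a i ^+ 2 * b j ^+ 2 + b i ^+ 2 * a j ^+ 2 - 2 * (a i * b i * (a j * b j)) by ring.
  rewrite (eq_bigr (fun i => a i ^+ 2 * (\sum_j b j ^+ 2) + b i ^+ 2 * (\sum_j a j ^+ 2)
      - 2 * (a i * b i * (\sum_j a j * b j)))).
    by rewrite sumrB big_split /= -!mulr_suml -mulr_sumr -mulr_suml; ring.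
  by move=> i _; rewrite (eq_bigr _ (fun j _ => E i j)) sumrB big_split /= -!mulr_sumr.
by rewrite pmulr_rge0// subr_ge0.
Qed.

Variables (n q : nat) (c : R).
Hypothesis hcq : (c = 1 /\ q = 0%N) \/ (c = -1 /\ q = 1%N).
Implicit Types v w z : 'rV[R]_n.+2.

Lemma inner0E v w : inner 0 v w = \sum_i v 0 i * w 0 i.
Proof. by apply: eq_bigr => i _; rewrite ltn0 expr0 mul1r. Qed.

Lemma inner1E v w :
  inner 1 v w = - (v 0 0 * w 0 0) + \sum_(i < n.+1) v 0 (lift ord0 i) * w 0 (lift ord0 i).
Proof.
rewrite /inner big_ord_recl expr1 mulN1r mulNr; congr (_ + _).
by apply: eq_bigr => i _; rewrite expr0 mul1r.
Qed.

Lemma sum_sqr_eq0 k (a : 'I_k -> R) : \sum_i a i ^+ 2 = 0 -> forall i, a i = 0.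
Proof.
move=> /eqP; rewrite psumr_eq0; last by move=> i _; exact: sqr_ge0.
by move=> /allP H i; apply/eqP; rewrite -sqrf_eq0; exact: H (mem_index_enum i).
Qed.

Lemma inner0_gt0 w : w != 0 -> 0 < inner 0 w w.
Proof.
move=> w0; rewrite inner0E lt_neqAle sumr_ge0 ?andbT; last by move=> i _; exact: sqr_ge0.
apply: contra w0; rewrite eq_sym => /eqP /sum_sqr_eq0 H.
by apply/eqP/rowP => i; rewrite mxE.
Qed.

(** For [c = -1] the vector [z] is timelike. Orthogonality equates the time product [t * s] with the
    spatial product [Y], so Cauchy-Schwarz gives [t ^+ 2 * s ^+ 2 <= Z * W] with [Z < t ^+ 2],
    whence [s ^+ 2 < W] unless [W = 0]. *)
Lemma spacelike z w : 0 < c * inner q z z -> inner q z w = 0 -> w != 0 ->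
  0 < inner q w w.
Proof.
case: hcq => -[-> ->] + + w0; first by move=> _ _; exact: inner0_gt0.
rewrite mulN1r !inner1E.
set t := z 0 0; set s := w 0 0.
set Z := \sum_(i < n.+1) z _ _ * z _ _; set W := \sum_(i < n.+1) w _ _ * w _ _.
set Y := \sum_(i < n.+1) z _ _ * w _ _ => tZ sY.
have CS : Y ^+ 2 <= Z * W by exact: sum_CauchySchwarz.
have W0 : 0 <= W by apply: sumr_ge0 => i _; exact: sqr_ge0.
have Z0 : 0 <= Z by apply: sumr_ge0 => i _; exact: sqr_ge0.
have {}sY : Y = t * s by lra.
rewrite sY in CS.
(* Without spatial part, Cauchy-Schwarz kills the time part of [w] too. *)
have [W00|W00] := eqVneq W 0.
  have s0 : s = 0.
    apply/eqP; rewrite -sqrf_eq0; apply/eqP; move: CS; rewrite W00 mulr0 exprMn => H.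
    have t2 : 0 < t ^+ 2 by rewrite expr2; lra.
    by apply/eqP; rewrite eq_le sqr_ge0 andbT -(pmulr_rle0 _ t2).
  case/eqP: w0; apply/rowP => i; rewrite mxE.
  case: (unliftP ord0 i) => [j ->|->//]; exact: (sum_sqr_eq0 W00).
have {}W0 : 0 < W by rewrite lt_neqAle eq_sym W00.
by nra.
Qed.

Lemma space_form_inner (y : 'rV[R]_n.+2) : space_form c y -> inner q y y = c.
Proof.
by case: hcq => -[-> ->]; rewrite /space_form; case: eqP => // [|_ []//]; lra.
Qed.

(** [y - z] is orthogonal to [y + z], both points having the same square; for [c = -1] the sum is
    timelike because both points lie on the upper sheet. *)
Lemma space_form_separation (y z : 'rV[R]_n.+2) : space_form c y -> space_form c z -> y != z ->
  0 < inner q (y - z) (y - z).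
Proof.
move=> hy hz yz; have yz0 : y - z != 0 by rewrite subr_eq0.
have [yc zc] := (space_form_inner hy, space_form_inner hz).
case: hcq => -[cE qE]; first by rewrite qE; exact: inner0_gt0.
apply: (@spacelike (y + z)) => //; last by rewrite innerDl !innerBr yc zc (innerC _ z y); ring.
rewrite innerDl !innerDr yc zc (innerC _ z y).
move: hy hz yc zc; rewrite cE qE /space_form; case: eqP => [|_]; first by lra.
move=> [_ y0] [_ z0]; rewrite !inner1E.
set Z := \sum_(i < n.+1) z _ _ * z _ _; set W := \sum_(i < n.+1) y _ _ * y _ _.
set Y := \sum_(i < n.+1) y _ _ * z _ _ => wc zc.
have CS : Y ^+ 2 <= W * Z by exact: sum_CauchySchwarz.
(* The spatial squares are [s ^+ 2 - 1] and [t ^+ 2 - 1], so Cauchy-Schwarz keeps [Y] strictly below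
   [s * t]. *)
suff : Y < y 0 0 * z 0 0 by lra.
move: y0 z0 wc zc CS; set s := y 0 0; set t := z 0 0 => s0 t0 wc zc.
have -> : W = s ^+ 2 - 1 by rewrite expr2; lra.
have -> : Z = t ^+ 2 - 1 by rewrite expr2; lra.
move=> CS; rewrite ltNge; apply/negP => H.
have st0 : 0 < s * t by rewrite mulr_gt0.
have : (s * t) ^+ 2 <= Y ^+ 2 by rewrite !expr2; nra.
have Z0 : 0 <= Z by apply: sumr_ge0 => i _; exact: sqr_ge0.
have W0 : 0 <= W by apply: sumr_ge0 => i _; exact: sqr_ge0.
by nra.
Qed.

End Causality.

(** * Estimates in the supremum norm *)

Section RowNorm.
Context {R : realType} {m : nat}.

Lemma normr_coord_le (v : 'rV[R]_m) i : `|v 0 i| <= `|v|.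
Proof.
rewrite [leRHS]/Num.Def.normr/= mx_normrE.
exact: (le_bigmax _ (fun ij : 'I_1 * 'I_m => `|v ij.1 ij.2|) (0, i)).
Qed.

Lemma normr_row_le (v : 'rV[R]_m) (b : R) : 0 <= b -> (forall i, `|v 0 i| <= b) -> `|v| <= b.
Proof.
move=> b0 vb; rewrite /Num.Def.normr/= mx_normrE (bigmax_le _ b0)//= => -[i j] _ /=.
by rewrite (ord1 i).
Qed.

Lemma normr_inner_le q (v w : 'rV[R]_m) : `|inner q v w| <= m%:R * (`|v| * `|w|).
Proof.
apply: le_trans (ler_norm_sum _ _ _) _.
rewrite mulr_natl -[X in _ *+ X]card_ord -sumr_const; apply: ler_sum => i _.
by rewrite !normrM normrX normrN1 expr1n mul1r ler_pM// normr_coord_le.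
Qed.

End RowNorm.

Lemma normr_mulmx_le (R : realType) m k (A : 'M[R]_(m, k)) :
  exists2 C : R, 0 < C & forall v : 'rV[R]_m, `|v *m A| <= C * `|v|.
Proof.
exists (1 + \sum_i \sum_j `|A i j|).
  by rewrite ltr_pwDl// sumr_ge0// => i _; exact: sumr_ge0.
move=> v; apply: normr_row_le => [|j].
  by rewrite mulr_ge0// addr_ge0// sumr_ge0// => i _; exact: sumr_ge0.
rewrite mxE; apply: le_trans (ler_norm_sum _ _ _) _.
rewrite mulrDl mul1r ler_wpDl// mulr_suml; apply: ler_sum => i _.
rewrite normrM mulrC ler_pM// ?normr_coord_le//.
by rewrite (bigD1 j)//= lerDl sumr_ge0.
Qed.

(** * Immersions near a point, and interior minima *)

Section Immersion.
Context {R : realType}.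

(** A left inverse of the differential gives [|z| <= C |df z|], while equal values give
    [|df z| <= |z| / (2 C)]; hence [|z| <= |z| / 2]. Only pairs containing the centre [u] are
    compared. *)
Lemma immersion_locally_injective n m (f : 'rV[R]_n -> 'rV[R]_m) u :
  differentiable f u -> injective ('d f u : 'rV[R]_n -> 'rV[R]_m) ->
  \forall z \near (0 : 'rV[R]_n), f (z + u) = f u -> z = 0.
Proof.
move=> fu inj; pose J := lin1_mx ('d f u).
have JE v : 'd f u v = v *m J by rewrite mul_rV_lin1.
have /row_freeP[K JK] : row_free J.
  rewrite -kermx_eq0; apply/negPn/negP => /rowV0Pn[v /sub_kermxP].
  by rewrite -JE -(linear0 ('d f u)) => /inj -> /eqP.
have [C C0 HC] := normr_mulmx_le K.
have C20 : 0 < (2 * C)^-1 by rewrite invr_gt0 mulr_gt0.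
have := differentiable_eps fu C20; apply: filterS => z H fz.
have {}H : `|'d f u z| <= (2 * C)^-1 * `|z|.
  by move: H; rewrite fz subrr sub0r normrN.
have zE : z = 'd f u z *m K by rewrite JE -mulmxA JK mulmx1.
have : `|z| <= C * ((2 * C)^-1 * `|z|).
  by rewrite {1}zE (le_trans (HC _))// ler_wpM2l// ltW.
have -> : C * ((2 * C)^-1 * `|z|) = 2^-1 * `|z| by field; rewrite gt_eqF.
move=> H2; apply/eqP; rewrite -normr_le0; move: H2; lra.
Qed.

Lemma differentiable_inner (V : normedModType R) m q (F G : V -> 'rV[R]_m) u :
  differentiable F u -> differentiable G u ->
  differentiable (fun z => inner q (F z) (G z)) u.
Proof.
move=> Fu Gu; have coord (H : V -> 'rV[R]_m) i : differentiable H u ->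
    differentiable (fun z => H z 0 i) u.
  move=> Hu; apply: (@differentiable_comp _ _ _ _ H (fun y : 'rV_m => y 0 i)) => //.
  exact: differentiable_coord.
rewrite (_ : (fun z => _) = \sum_(i < m) (fun z => cst ((-1) ^+ (i < q)%N) z * F z 0 i * G z 0 i)); last first.
  by apply/funext => z; rewrite fct_sumE.
apply: differentiable_sum => i; apply: differentiableM; last exact: coord.
by apply: differentiableM; [exact: differentiable_cst|exact: coord].
Qed.

Lemma derive_at_min (V : normedModType R) (f : V -> R) u v (d df : R) : 0 < d ->
  (forall t : R, `|t| < d -> derivable f (t *: v + u) v) ->
  (forall t : R, `|t| < d -> f u <= f (t *: v + u)) ->
  is_derive u v f df -> df = 0.
Proof.
move=> d0 fd fmin fu.
have abs_lt (t : R) : t \in `]-d, d[%R -> `|t| < d by rewrite in_itv /= ltr_norml.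
have [] : is_derive (0 : R) 1 (fun t : R => f (t *: v + u)) 0.
  apply: (@derive1_at_min _ _ (- d) d) => [|t /abs_lt td||t /abs_lt td].
  - by rewrite ge0_cp// ltW.
  - by have [] := is_derive_line (derivableP (fd _ td)).
  - by rewrite in_itv /= oppr_lt0 d0.
  - by rewrite scale0r add0r fmin.
move=> _ <-.
have fu' : is_derive (0 *: v + u) v f df by rewrite scale0r add0r.
by have [_ <-] := is_derive_line fu'.
Qed.

End Immersion.

(** * Hypersurfaces in a chart *)

(* Comparing two iterated partial derivatives by unfolding them diverges, so
   they are locked. *)
Fact lpartial_key : unit. Proof. exact: tt. Qed.

Definition lpartial (R : realType) (n : nat) (V : normedModType R) (i : 'I_n)
  (f : 'rV[R]_n -> V) : 'rV[R]_n -> V := locked_with lpartial_key (partial i f).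

Lemma lpartialE (R : realType) (n : nat) (V : normedModType R) (i : 'I_n)
  (f : 'rV[R]_n -> V) : lpartial i f = partial i f.
Proof. by rewrite /lpartial unlock. Qed.

Section LocalHypersurface.
Context {R : realType} {n : nat}.
Variables (q : nat) (c : R).
Hypothesis hcq : (c = 1 /\ q = 0%N) \/ (c = -1 /\ q = 1%N).
Variables (X N : 'rV[R]_n -> 'rV[R]_n.+2) (U : set 'rV[R]_n).
Hypotheses (oU : open U) (sX : smooth_on U X) (sN : smooth_on U N).
Hypothesis XX : forall u, U u -> inner q (X u) (X u) = c.
Hypothesis NN : forall u, U u -> inner q (N u) (N u) = 1.
Hypothesis NX : forall u, U u -> inner q (N u) (X u) = 0.
Hypothesis NdX : forall u, U u -> forall v, inner q (N u) ('d X u v) = 0.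
Hypothesis dX_inj : forall u, U u -> injective ('d X u : 'rV[R]_n -> 'rV[R]_n.+2).

Local Notation e_ i := (delta_mx 0 i : 'rV[R]_n).
Local Notation X_ i := (lpartial i X).
Local Notation N_ i := (lpartial i N).
Local Notation X__ i j := (lpartial i (lpartial j X)).
Local Notation "<< v , w >>" := (inner q v w) : ring_scope.
Local Notation g := (induced_metric q X).
Local Notation gi := (inv_metric q X).

Lemma c_sqr : c * c = 1.
Proof. by case: hcq => -[-> _]; rewrite ?mulr1// mulrNN mulr1. Qed.

Lemma nearU u : U u -> \forall z \near u, U z.
Proof. by move=> Uu; exact: open_nbhs_nbhs. Qed.

Lemma is_derive_partial (V : normedModType R) (f : 'rV[R]_n -> V) i u :
  differentiable f u -> is_derive u (e_ i) f (partial i f u).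
Proof. by move=> fu; apply: DeriveDef => //; exact: diff_derivable. Qed.

Lemma partialE (V : normedModType R) (f : 'rV[R]_n -> V) i u :
  partial i f u = 'D_(e_ i) f u.
Proof. by []. Qed.

Lemma partial_val (V : normedModType R) (f : 'rV[R]_n -> V) i u df :
  is_derive u (e_ i) f df -> partial i f u = df.
Proof. by case. Qed.

Lemma near_eq_partial (V : normedModType R) (f h : 'rV[R]_n -> V) i u :
  U u -> (forall z, U z -> f z = h z) -> partial i f u = partial i h u.
Proof.
move=> Uu fh; apply: near_eq_derive; near=> z; apply: fh; near: z; exact: nearU.
Unshelve. all: by end_near. Qed.

Lemma derX i u : U u -> is_derive u (e_ i) X (X_ i u).
Proof. by move=> Uu; rewrite lpartialE; apply: is_derive_partial; exact: (sX [::]). Qed.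

Lemma derN i u : U u -> is_derive u (e_ i) N (N_ i u).
Proof. by move=> Uu; rewrite lpartialE; apply: is_derive_partial; exact: (sN [::]). Qed.

Lemma differentiable_X_ j u : U u -> differentiable (X_ j) u.
Proof. by move=> Uu; rewrite lpartialE; exact: (sX [:: j]). Qed.

Lemma derX2 i j u : U u -> is_derive u (e_ i) (X_ j) (X__ i j u).
Proof.
by move=> Uu; rewrite (lpartialE i); apply: is_derive_partial; exact: differentiable_X_.
Qed.

Lemma metricE u i j : g u i j = <<X_ i u, X_ j u>>.
Proof. by rewrite mxE !lpartialE. Qed.

Lemma dXE u v : U u -> 'd X u v = \sum_i v 0 i *: X_ i u.
Proof.
move=> Uu; rewrite [in LHS](row_sum_delta v) linear_sum; apply: eq_bigr => i _.
by rewrite linearZ /= lpartialE partialE deriveE//; exact: (sX [::]).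
Qed.

(** The product rule for a constant pairing, source of most relations between the frame [X], [N],
    [X_ i] and its derivatives. *)
Lemma partial_inner_cst (F G : 'rV[R]_n -> 'rV[R]_n.+2) k i u dF dG : U u ->
  (forall z, U z -> <<F z, G z>> = k) ->
  is_derive u (e_ i) F dF -> is_derive u (e_ i) G dG ->
  <<dF, G u>> + <<F u, dG>> = 0.
Proof.
move=> Uu H hF hG; have := is_derive_inner q hF hG => -[_ <-].
rewrite -[RHS](derive_cst k u (e_ i)).
by apply: near_eq_derive; near=> z; apply: H; near: z; exact: nearU.
Unshelve. all: by end_near. Qed.

Lemma NX_ i u : U u -> <<N u, X_ i u>> = 0.
Proof. by move=> Uu; rewrite lpartialE partialE deriveE ?NdX//; exact: (sX [::]). Qed.

Lemma XX_ i u : U u -> <<X u, X_ i u>> = 0.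
Proof.
move=> Uu; have := partial_inner_cst Uu XX (derX i Uu) (derX i Uu).
by rewrite (innerC _ (X_ i u)) => H; lra.
Qed.

Lemma NN_ i u : U u -> <<N u, N_ i u>> = 0.
Proof.
move=> Uu; have := partial_inner_cst Uu NN (derN i Uu) (derN i Uu).
by rewrite (innerC _ (N_ i u)) => H; lra.
Qed.

Lemma N_X i u : U u -> <<N_ i u, X u>> = 0.
Proof.
move=> Uu; have := partial_inner_cst Uu NX (derN i Uu) (derX i Uu).
by rewrite NX_// addr0.
Qed.

Lemma XX__ i j u : U u -> <<X u, X__ i j u>> = - g u i j.
Proof.
move=> Uu; have := partial_inner_cst Uu (fun z Uz => XX_ j Uz) (derX i Uu) (derX2 i j Uu).
by rewrite metricE => H; lra.
Qed.

Lemma NX__ i j u : U u -> <<N u, X__ i j u>> = - <<N_ i u, X_ j u>>.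
Proof.
move=> Uu; have := partial_inner_cst Uu (fun z Uz => NX_ j Uz) (derN i Uu) (derX2 i j Uu).
by move=> H; lra.
Qed.

Lemma X__C i j u : U u -> X__ i j u = X__ j i u.
Proof.
move=> Uu; apply/rowP => a.
have dif k : differentiable (fun z => X_ k z 0 a) u.
  apply: (@differentiable_comp _ _ _ _ (X_ k) (fun y : 'rV_n.+2 => y 0 a)).
    exact: differentiable_X_.
  exact: differentiable_coord.
have E k l : X__ k l u 0 a = 'D_(e_ k) (fun z => X_ l z 0 a) u.
  by have [_ H] := is_derive_coord a (derX2 k l Uu); exact: esym H.
apply: (etrans (E i j)); apply: (etrans _ (esym (E j i))).
apply: (@derive_comm _ _ (fun z => X z 0 a)) => //.
  by near=> z; apply: is_derive_coord; apply: derX; near: z; exact: nearU.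
by near=> z; apply: is_derive_coord; apply: derX; near: z; exact: nearU.
Unshelve. all: by end_near. Qed.

(** Pairing a vanishing combination with [X] and [N] kills their coefficients and injectivity of the
    differential kills the rest, so the [n + 2] frame vectors form a basis; the metric is
    nondegenerate. *)
Lemma frame_complete u w : U u ->
  (forall i, <<X_ i u, w>> = 0) -> <<N u, w>> = 0 -> <<X u, w>> = 0 -> w = 0.
Proof.
move=> Uu X0 N0 x0.
pose E : 'M[R]_n.+2 := col_mx (col_mx (X u) (N u) : 'M[R]_(2, n.+2)) (\matrix_i (X_ i u)).
have Efree : row_free E.
  rewrite -kermx_eq0; apply/negPn/negP => /rowV0Pn[v /sub_kermxP].
  have [v1 [v2 [v3 ->]]] : exists (a b : 'M[R]_1) (t : 'rV[R]_n),
      v = row_mx (row_mx a b : 'rV[R]_(1 + 1)) t :> 'rV[R]_(2 + n).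
    exists (@lsubmx _ 1 1 1 (@lsubmx _ 1 2 n v)), (@rsubmx _ 1 1 1 (@lsubmx _ 1 2 n v)), (@rsubmx _ 1 2 n v).
    by rewrite (@hsubmxK _ 1 1 1) (@hsubmxK _ 1 2 n).
  rewrite /E (@mul_row_col _ 1 2 n) (@mul_row_col _ 1 1 1).
  rewrite [v1]mx11_scalar [v2]mx11_scalar !mul_scalar_mx mulmx_sum_row.
  under eq_bigr do rewrite rowK.
  rewrite -dXE// => H v0.
  have v10 : v1 0 0 = 0.
    have := congr1 (fun z => inner q z (X u)) H.
    rewrite !innerDl !innerZl NX// XX// inner0l dXE// inner_suml big1; last first.
      by move=> i _; rewrite innerZl innerC XX_// mulr0.
    by rewrite mulr0 !addr0 => /(congr1 (fun z => z * c)); rewrite -mulrA c_sqr mulr1 mul0r.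
  have v20 : v2 0 0 = 0.
    have := congr1 (fun z => inner q (N u) z) H.
    by rewrite !innerDr !innerZr NX// NN// inner0r NdX// mulr0 add0r addr0 mulr1.
  move: H; rewrite v10 v20 !scale0r !add0r -(linear0 ('d X u)) => /(dX_inj Uu) v30.
  case/eqP: v0; rewrite v30 v10 v20.
  by rewrite !raddf0 !row_mx0.
have : E *m (signature_mx q *m w^T) = 0.
  have row_eq0 (z : 'rV[R]_n.+2) : inner q z w = 0 -> z *m (signature_mx q *m w^T) = 0.
    by move=> zw; apply/matrixP => i j; rewrite (ord1 i) (ord1 j) mulmxA -inner_mxE zw mxE.
  rewrite /E (@mul_col_mx _ 2 n) (@mul_col_mx _ 1 1) !row_eq0//.
  have -> : (\matrix_i (X_ i u)) *m (signature_mx q *m w^T) = 0.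
    by apply/row_matrixP => i; rewrite row_mul rowK row_eq0// row0.
  by rewrite !col_mx0.
move: Efree; rewrite row_free_unit => Eu.
move=> /(congr1 (mulmx (invmx E))); rewrite mulKmx// mulmx0.
move=> /(congr1 (mulmx (invmx (signature_mx q)))); rewrite mulKmx ?signature_mx_unit// mulmx0.
by move=> /(congr1 trmx); rewrite trmxK trmx0.
Qed.

Lemma induced_metric_sym u : (g u)^T = g u.
Proof. by apply/matrixP => i j; rewrite mxE !metricE innerC. Qed.

(** Tangent vectors are orthogonal to [X] and [c <X, X> = 1], so [spacelike] applies in both ambient
    spaces. *)
Lemma induced_metric_gt0 u : U u -> forall v : 'rV[R]_n, v != 0 -> 0 < (v *m g u *m v^T) 0 0.
Proof.
move=> Uu v v0; have -> : (v *m g u *m v^T) 0 0 = <<'d X u v, 'd X u v>>.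
  rewrite mxE dXE// inner_suml; apply: eq_bigr => j _; rewrite innerZl [v^T _ _]mxE mulrC; congr (_ * _).
  by rewrite mxE innerC inner_suml; apply: eq_bigr => i _; rewrite innerZl metricE.
apply: (spacelike (z := X u) hcq); first by rewrite XX// c_sqr.
  by rewrite dXE// innerC inner_suml big1// => i _; rewrite innerZl innerC XX_// mulr0.
by apply: contra v0 => /eqP; rewrite -(linear0 ('d X u)) => /(dX_inj Uu) ->.
Qed.

Lemma induced_metric_unit u : U u -> g u \in unitmx.
Proof.
move=> Uu; rewrite -row_free_unit -kermx_eq0; apply/negPn/negP => /rowV0Pn[v].
move=> /sub_kermxP vg v0; have := induced_metric_gt0 Uu v0.
by rewrite vg mul0mx mxE ltxx.
Qed.

Local Notation S := (shape_operator c q X N).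

Lemma mul_metric_tangent_coord u w i : U u ->
  (g u *m tangent_coord q X u w) i 0 = <<X_ i u, w>>.
Proof.
by move=> Uu; rewrite mulmxA mulmxV ?induced_metric_unit// mul1mx mxE lpartialE.
Qed.

(** The difference of the two sides is orthogonal to the whole frame. The factor [c] is the inverse
    of [<X, X> = c]. *)
Lemma frame_decomposition u w : U u ->
  w = <<N u, w>> *: N u + (c * <<X u, w>>) *: X u
      + \sum_m tangent_coord q X u w m 0 *: X_ m u.
Proof.
move=> Uu; apply/eqP; rewrite -subr_eq0; apply/eqP.
have sum0 z : (forall m, <<z, X_ m u>> = 0) ->
    <<z, \sum_m tangent_coord q X u w m 0 *: X_ m u>> = 0.
  move=> z0; rewrite innerC inner_suml big1// => m _.
  by rewrite innerZl innerC z0 mulr0.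
apply: (frame_complete Uu) => [i||]; rewrite innerBr !innerDr !innerZr.
- rewrite (innerC _ _ (N u)) (innerC _ _ (X u)) NX_// XX_// !mulr0 !add0r.
  rewrite (innerC _ _ (\sum_m _)) inner_suml -mul_metric_tangent_coord// mxE.
  apply/eqP; rewrite subr_eq0; apply/eqP; apply: eq_bigr => m _.
  by rewrite innerZl metricE mulrC; congr (_ * _); exact: innerC.
- by rewrite NN// NX// mulr0 mulr1 addr0 sum0 ?addr0 ?subrr// => m; exact: NX_.
- rewrite (innerC _ _ (N u)) NX// XX// mulr0 add0r mulrAC c_sqr mul1r sum0 ?addr0 ?subrr// => m.
  exact: XX_.
Qed.

(** The second fundamental form in coordinates; the correction along [X] in [nabla_bar] vanishes
    since [<N_l, X> = 0]. *)
Lemma mul_metric_shape u k l : U u -> (g u *m S u) k l = <<N u, X__ l k u>>.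
Proof.
move=> Uu; have -> : (g u *m S u) k l = (g u *m tangent_coord q X u (- nabla_bar c q X N l u)) k 0.
  rewrite [LHS]mxE [RHS]mxE; apply: eq_bigr => i _; congr (_ * _).
  by rewrite /shape_operator mxE.
rewrite mul_metric_tangent_coord// innerNr /nabla_bar innerBr innerZr -lpartialE.
by rewrite N_X// mulr0 mul0r subr0 (NX__ _ _ Uu) innerC.
Qed.

Lemma mul_metric_shape_sym u : U u -> (g u *m S u)^T = g u *m S u.
Proof.
move=> Uu; apply/matrixP => i j; rewrite mxE (mul_metric_shape _ _ Uu) (X__C _ _ Uu).
exact: esym (mul_metric_shape _ _ Uu).
Qed.

Lemma shape_split u : U u ->
  exists kappa : 'rV[R]_n, char_poly (S u) = \prod_(i < n) ('X - (kappa 0 i)%:P).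
Proof.
move=> Uu; apply: char_poly_self_adjoint (induced_metric_gt0 Uu) _ _.
  exact: induced_metric_sym.
exact: mul_metric_shape_sym.
Qed.

(** * Christoffel symbols, Hessian and the Gauss formula *)

Lemma is_derive_metric i j k u : U u ->
  is_derive u (e_ i) (fun z => g z j k) (<<X__ i j u, X_ k u>> + <<X_ j u, X__ i k u>>).
Proof.
move=> Uu; rewrite (_ : (fun z => _) = (fun z => <<X_ j z, X_ k z>>)).
  exact: is_derive_inner (derX2 i j Uu) (derX2 i k Uu).
by apply/funext => z; rewrite metricE.
Qed.

Lemma partial_metric i j k u : U u ->
  partial i (fun z => g z j k) u = <<X__ i j u, X_ k u>> + <<X_ j u, X__ i k u>>.
Proof. by move=> Uu; rewrite (partial_val (is_derive_metric i j k Uu)). Qed.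

Lemma derivable_inv_metric i j k u : U u -> derivable (fun z => gi z j k) u (e_ i).
Proof.
move=> Uu; apply: derivable_invmx => [a b|].
  by have [] := is_derive_metric i a b Uu.
by near=> z; apply: induced_metric_unit; near: z; exact: nearU.
Unshelve. all: by end_near. Qed.

Lemma metric_grad f u k : U u -> \sum_i g u k i * grad q X f i u = partial k f u.
Proof.
move=> Uu; have -> : \sum_i g u k i * grad q X f i u =
    (g u *m (gi u *m \col_j partial j f u)) k 0.
  rewrite mxE; apply: eq_bigr => i _; congr (_ * _); rewrite mxE.
  by apply: eq_bigr => j _; rewrite mxE.
by rewrite mulmxA mulmxV ?induced_metric_unit// mul1mx mxE.
Qed.

(** Christoffel symbols of the first kind: by symmetry of the second partials, the combination of
    metric derivatives collapses to twice a single pairing. *)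
Lemma metric_christoffel u k l m : U u ->
  \sum_i g u k i * christoffel q X i l m u = <<X__ l m u, X_ k u>>.
Proof.
move=> Uu; pose G (p : 'I_n) := partial l (fun v => g v m p) u
     + partial m (fun v => g v l p) u - partial p (fun v => g v l m) u.
have -> : \sum_i g u k i * christoffel q X i l m u =
    2^-1 * (g u *m (gi u *m \col_p G p)) k 0.
  rewrite mxE mulr_sumr; apply: eq_bigr => i _; rewrite mulrCA; congr (_ * (_ * _)).
  by rewrite [RHS]mxE; apply: eq_bigr => j _; congr (_ * _); rewrite mxE.
rewrite mulmxA mulmxV ?induced_metric_unit// mul1mx mxE.
have key (A B C xk xm xl : 'rV[R]_n.+2) :
    2^-1 * (<<A, xk>> + <<xm, B>> + (<<A, xk>> + <<xl, C>>) - (<<B, xm>> + <<xl, C>>)) = <<A, xk>>.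
  by rewrite (innerC _ xm); field.
apply: etrans (key _ (X__ l k u) (X__ m k u) _ (X_ m u) (X_ l u)); congr (_ * _).
congr (_ + _ - _); first exact: partial_metric.
  rewrite (partial_metric m l k Uu); apply: (congr1 (fun A => <<A, X_ k u>> + _)).
  exact: X__C.
rewrite (partial_metric k l m Uu).
apply: (congr2 (fun A B => <<A, X_ m u>> + <<X_ l u, B>>)); exact: X__C.
Qed.

(* Lowering the index of the Hessian removes the derivatives of the inverse
   metric and leaves the tangential part of the flat second derivative. *)
Lemma metric_hessian f u k l : U u ->
  (forall j, derivable (partial j f) u (e_ l)) ->
  (g u *m hessian q X f u) k l =
  partial l (partial k f) u - \sum_m <<X__ l k u, X_ m u>> * grad q X f m u.
Proof.
move=> Uu df; have dgrad i : derivable (grad q X f i) u (e_ l).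
  apply: derivable_sum_fct => j.
  by apply: derivableM; [exact: derivable_inv_metric|exact: df].
have E : partial l (partial k f) u =
    \sum_i (partial l (fun z => g z k i) u * grad q X f i u + g u k i * partial l (grad q X f i) u).
  have H : is_derive u (e_ l) (fun z => \sum_i g z k i * grad q X f i z)
      (\sum_i (partial l (fun z => g z k i) u * grad q X f i u + g u k i * partial l (grad q X f i) u)).
    apply: is_derive_sum_fct => i; apply: is_derive_mul; rewrite partialE; apply: DeriveDef => //.
    by have [] := is_derive_metric l k i Uu.
  by rewrite -(partial_val H); apply: near_eq_partial => // z Uz; rewrite metric_grad.
have L : (g u *m hessian q X f u) k l =
    \sum_i g u k i * partial l (grad q X f i) u + \sum_m <<X__ l m u, X_ k u>> * grad q X f m u.
  rewrite mxE (eq_bigr (fun i => g u k i * partial l (grad q X f i) u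
      + \sum_m g u k i * christoffel q X i l m u * grad q X f m u)); last first.
    move=> i _; rewrite [hessian _ _ _ _ _ _]mxE mulrDr mulr_sumr; congr (_ + _).
    by apply: eq_bigr => m _; rewrite mulrA.
  rewrite big_split /=; congr (_ + _); rewrite exchange_big /=; apply: eq_bigr => m _.
  by rewrite -mulr_suml (metric_christoffel _ _ _ Uu).
have D : \sum_i partial l (fun z => g z k i) u * grad q X f i u =
    \sum_m <<X__ l k u, X_ m u>> * grad q X f m u + \sum_m <<X__ l m u, X_ k u>> * grad q X f m u.
  rewrite -big_split /=; apply: eq_bigr => m _.
  by rewrite (partial_metric _ _ _ Uu) (innerC _ (X_ k u)) mulrDl.
rewrite L E big_split /= D.
move: (\sum_m <<X__ l k u, _>> * _) (\sum_m _) (\sum_m _) => a1 a2 a3; ring.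
Qed.

(** The frame decomposition of the second derivative without its tangential part; the coefficient of
    [X] comes from [<X, X_lk> = - g_lk]. *)
Lemma gauss_formula u k l : U u ->
  X__ l k u - \sum_m tangent_coord q X u (X__ l k u) m 0 *: X_ m u =
  <<N u, X__ l k u>> *: N u - (c * g u k l) *: X u.
Proof.
move=> Uu; apply/eqP; rewrite subr_eq eq_sym; apply/eqP.
rewrite [RHS](frame_decomposition _ Uu); congr (_ + _ + _).
rewrite (XX__ _ _ Uu) -scaleNr -mulrN; congr ((c * - _) *: _).
by rewrite !metricE; exact: innerC.
Qed.

(** Component [a] of the Gauss formula: lowered by the metric, the Hessian is that component of the
    non-tangential part of the second derivative, and the metric is then cancelled. *)
Lemma hessian_position u a : U u ->
  hessian q X (fun z => X z 0 a) u = N u 0 a *: S u - (c * X u 0 a)%:M.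
Proof.
move=> Uu; apply: (can_inj (mulKmx (induced_metric_unit Uu))).
have P k z : U z -> partial k (fun y => X y 0 a) z = X_ k z 0 a.
  by move=> Uz; rewrite (partial_val (is_derive_coord a (derX k Uz))).
apply/matrixP => k l; rewrite metric_hessian//; last first.
  move=> j; apply: (@near_eq_derivable _ _ _ (fun z => X_ j z 0 a)).
    by near=> z; rewrite P//; near: z; exact: nearU.
  by have [] := is_derive_coord a (derX2 l j Uu).
have -> : partial l (partial k (fun z => X z 0 a)) u = X__ l k u 0 a.
  rewrite -(partial_val (is_derive_coord a (derX2 l k Uu))).
  by apply: near_eq_partial => // z Uz; exact: P.
(* By symmetry of the inverse metric, contracting with the gradient yields component [a] of the
   tangential part. *)
have gsum : \sum_m <<X__ l k u, X_ m u>> * grad q X (fun z => X z 0 a) m u =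
    (\sum_m tangent_coord q X u (X__ l k u) m 0 *: X_ m u) 0 a.
  rewrite summxE; under eq_bigr => m _ do rewrite mulr_sumr.
  rewrite exchange_big /=; apply: eq_bigr => j _; rewrite !mxE mulr_suml.
  apply: eq_bigr => m _; rewrite P// !mxE innerC mulrA; congr (_ * _); rewrite mulrC; congr (_ * _).
    by rewrite -[in RHS](trmxK (gi u)) mxE trmx_inv induced_metric_sym.
  by rewrite lpartialE.
have mxB (A B : 'M[R]_n) x y : (x *: A - y *: B) k l = x * A k l - y * B k l by rewrite !mxE.
have rowB (v w : 'rV[R]_n.+2) : (v - w) 0 a = v 0 a - w 0 a by rewrite !mxE.
have rowZ (v : 'rV[R]_n.+2) x : (x *: v) 0 a = x * v 0 a by rewrite !mxE.
have := congr1 (fun w : 'rV_n.+2 => w 0 a) (gauss_formula k l Uu).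
rewrite /= !rowB !rowZ gsum => ->.
rewrite mulmxBr -scalemxAr mul_mx_scalar mxB (mul_metric_shape _ _ Uu).
by move: (g u k l) <<N u, _>> => x y; ring.
Unshelve. all: by end_near. Qed.

Lemma linearized_positionE k u a : U u ->
  linearized c q X N k (fun z => X z 0 a) u =
  \tr (S u *m newton (S u) k) * N u 0 a - c * \tr (newton (S u) k) * X u 0 a.
Proof.
move=> Uu; rewrite /linearized hessian_position// mulmxBr -scalemxAr raddfB /= mxtraceZ.
by rewrite mxtrace_mulC mul_mx_scalar mxtraceZ; ring.
Qed.

(** Without tangential part, [w] lies in the plane of [N] and [X]. Differentiating [<w, X_k> = 0]
    gives [<w, X_lk> = 0], which ties the second fundamental form to the metric. *)
Lemma constant_normal_field w : (forall u i, U u -> <<w, X_ i u>> = 0) ->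
  forall u, U u ->
  [/\ w = <<N u, w>> *: N u + (c * <<X u, w>>) *: X u,
      <<w, w>> = <<N u, w>> ^+ 2 + c * <<X u, w>> ^+ 2 &
      <<N u, w>> *: S u = (c * <<X u, w>>)%:M].
Proof.
move=> wX u Uu.
have E : w = <<N u, w>> *: N u + (c * <<X u, w>>) *: X u.
  rewrite [LHS](frame_decomposition w Uu) [X in _ + X]big1 ?addr0// => m _.
  rewrite mxE big1 ?scale0r// => j _.
  by rewrite [X in _ * X]mxE -lpartialE innerC wX// mulr0.
split=> //.
  rewrite {1}E innerDl !innerZl; ring.
apply: (can_inj (mulKmx (induced_metric_unit Uu))); apply/matrixP => k l.
have mxZ (A : 'M[R]_n) x : (x *: A) k l = x * A k l by rewrite !mxE.
rewrite -scalemxAr mul_mx_scalar !mxZ (mul_metric_shape _ _ Uu).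
have : <<w, X__ l k u>> = 0.
  have := partial_inner_cst Uu (fun z Uz => wX z k Uz) (is_derive_cst w u (e_ l)) (derX2 l k Uu).
  by rewrite inner0l add0r.
rewrite {1}E innerDl !innerZl (XX__ _ _ Uu).
have -> : g u l k = g u k l by rewrite !metricE; exact: innerC.
by move: (g u k l) <<N u, X__ l k u>> => x y H; lra.
Qed.

(** * Openness of the image in a slice *)

(** Criticality puts [y] in the plane of [N u] and [X u]. There the constraints leave the squared
    distance 0 and at most one other value, which the strict bound excludes. *)
Lemma slice_critical_point a tau u y : U u ->
  (forall z, U z -> <<a, X z>> = tau) ->
  0 < <<a, a>> - c * tau ^+ 2 ->
  <<y, y>> = c -> <<a, y>> = tau -> 0 <= <<X u - y, X u - y>> ->
  <<X u - y, X u - y>> * (<<a, a>> - c * tau ^+ 2 + tau ^+ 2) < 4 * (<<a, a>> - c * tau ^+ 2) ->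
  (forall i, <<X_ i u, y>> = 0) -> <<X u - y, X u - y>> = 0.
Proof.
move=> Uu aX d0 yy ay D0 Dlt yX.
have cc := c_sqr.
have aX_ z i : U z -> <<a, X_ i z>> = 0.
  move=> Uz; have := partial_inner_cst Uz aX (is_derive_cst a z (e_ i)) (derX i Uz).
  by rewrite inner0l add0r.
have [aE aa _] := constant_normal_field (fun z i Uz => aX_ z i Uz) Uu.
have yE : y = <<N u, y>> *: N u + (c * <<X u, y>>) *: X u.
  rewrite [LHS](frame_decomposition y Uu).
  rewrite [X in _ + X]big1 ?addr0// => m _; rewrite mxE big1 ?scale0r// => j _.
  by rewrite [X in _ * X]mxE -lpartialE yX mulr0.
have XaE : <<X u, a>> = tau by rewrite innerC aX.
rewrite XaE in aE aa.
have DE : <<X u - y, X u - y>> = 2 * c - 2 * <<X u, y>>.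
  by rewrite innerBl !innerBr yy (XX Uu) (innerC _ y); ring.
move: D0 Dlt; rewrite DE.
have : <<y, y>> = <<N u, y>> ^+ 2 + c * <<X u, y>> ^+ 2.
  by rewrite {1}yE innerDl !innerZl; ring.
have : <<a, y>> = <<N u, a>> * <<N u, y>> + c * tau * <<X u, y>>.
  by rewrite {1}aE innerDl !innerZl.
rewrite yy ay aa.
move: d0; rewrite aa.
move: <<N u, y>> <<N u, a>> <<X u, y>> => ga be th.
rewrite addrK => be0 ayE yyE.
(* [D] is the squared distance, in terms of which [<X u, y> = c - D / 2]. *)
have [D thE] : exists D, th = c - D / 2 by exists (2 * c - 2 * th); field.
have -> : 2 * c - 2 * th = D by rewrite thE; field.
rewrite thE in ayE yyE => D0 Dlt.
have E1 : be * ga = c * tau * D / 2.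
  have : c * tau * (c - D / 2) = (c * c) * tau - c * tau * D / 2 by field.
  by rewrite cc mul1r; move: ayE; lra.
have E2 : ga ^+ 2 = D - c * D ^+ 2 / 4.
  have : c * (c - D / 2) ^+ 2 = (c * c) * c - (c * c) * D + c * D ^+ 2 / 4 by field.
  by rewrite cc; move: yyE; lra.
(* Elimination of [ga] between [E1] and [E2]. *)
have E3 : D * (tau ^+ 2 * D) = D * (be ^+ 2 * (4 - c * D)).
  have : (be * ga) ^+ 2 = be ^+ 2 * (D - c * D ^+ 2 / 4) by rewrite exprMn E2.
  rewrite E1 (_ : (c * tau * D / 2) ^+ 2 = (c * c) * (D * (tau ^+ 2 * D)) / 4); last by field.
  rewrite cc mul1r => H; have -> : D * (be ^+ 2 * (4 - c * D)) = 4 * (be ^+ 2 * (D - c * D ^+ 2 / 4)) by field.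
  by rewrite -H; field.
have [//|Dn0] := eqVneq D 0.
have {}E3 := mulfI Dn0 E3.
(* A nonzero [D] satisfies [D (tau^2 + c be^2) = 4 be^2], against [D (tau^2 + be^2) < 4 be^2]; for
   [c = -1] this also uses [0 <= D be^2]. *)
exfalso; move: E3 Dlt be0; case: hcq => -[-> _]; move: (tau ^+ 2) (be ^+ 2) (sqr_ge0 tau) => t b t0; first by nra.
by move=> H1 H2 b0; have : 0 <= D * b; [rewrite mulr_ge0// ltW|nra].
Qed.

Lemma local_slice a tau u0 : U u0 ->
  (forall z, U z -> space_form c (X z)) ->
  (forall z, U z -> <<a, X z>> = tau) ->
  0 < <<a, a>> - c * tau ^+ 2 ->
  exists2 e : R, 0 < e & forall y, space_form c y -> <<a, y>> = tau ->
    `|y - X u0| < e -> exists2 u, U u & y = X u.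
Proof.
move=> Uu0 Xc aX d0; set delta := <<a, a>> - c * tau ^+ 2 in d0.
(* On this closed ball, inside the chart domain, [X] takes the value [X u0] only at the centre. *)
have [r r0 rP] : exists2 r : R, 0 < r & forall u, `|u - u0| <= r ->
    U u /\ (X u = X u0 -> u = u0).
  have inj := immersion_locally_injective (sX [::] Uu0) (dX_inj Uu0).
  have nU : \forall z \near (0 : 'rV[R]_n), U (z + u0).
    by have := nearU Uu0; rewrite (near_shift (0 : 'rV[R]_n)) /= subr0.
  have /nbhs_norm0P[d /= dpos dP] : \forall z \near (0 : 'rV[R]_n),
      (X (z + u0) = X u0 -> z = 0) /\ U (z + u0) by exact: filterI.
  exists (d / 2); first by rewrite divr_gt0.
  move=> u ud; have /dP : [set y | `|y| < d] (u - u0).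
    by rewrite /=; apply: le_lt_trans ud _; rewrite ltr_pdivrMr// ltr_pMr// ltr1n.
  rewrite subrK => -[h1 h2]; split=> // /h1 /eqP; rewrite subr_eq0 => /eqP.
  by [].
pose f y u := <<X u - y, X u - y>>.
have fdiff y u : U u -> differentiable (f y) u.
  by move=> Uu; apply: differentiable_inner; apply: differentiableB => //;
    exact: (sX [::]).
pose B := [set u | `|u - u0| <= r].
pose Sph := [set u | `|u - u0| = r].
have ncont : continuous (fun u : 'rV[R]_n => `|u - u0|).
  move=> u; have ud : differentiable (fun z : 'rV[R]_n => z - u0) u by apply: differentiableB.
  exact: cvg_norm (differentiable_continuous ud).
have Bbnd : bounded_set B.
  exists (`|u0| + r); split; first exact: num_real.
  move=> M hM u /= uB; apply: ltW; apply: le_lt_trans hM.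
  by rewrite -[u](subrK u0) (le_trans (ler_normD _ _))// addrC lerD2l.
have Bcpt : compact B.
  apply: bounded_closed_compact => //.
  by apply: (@preimage_closed _ _ _ [set t | t <= r]) => [u _|]; [exact: ncont|exact: closed_le].
have SB : Sph `<=` B by move=> u us; rewrite /B /= us.
have Scpt : compact Sph.
  apply: subclosed_compact Bcpt SB.
  by apply: (@preimage_closed _ _ _ [set t | t = r]) => [u _|]; [exact: ncont|exact: closed_eq].
have fcont y (E : set 'rV[R]_n) : E `<=` B -> {within E, continuous (f y)}.
  move=> EB; apply: continuous_in_subspaceT => u /set_mem /EB /rP [Uu _].
  exact/differentiable_continuous/fdiff.
(* A positive barrier on the bounding sphere, from compactness and separation; an empty sphere
   admits any bound. *)
have [m m0 mP] : exists2 m : R, 0 < m & forall u, Sph u -> m <= f (X u0) u.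
  have [Sne|Se] := pselect (Sph !=set0); last first.
    by exists 1 => // u Su; case: Se; exists u.
  have [v /set_mem vS vmin] := EVT_min_rV Sne Scpt (fcont (X u0) Sph SB).
  have [Uv vinj] := rP v (SB v vS).
  exists (f (X u0) v) => [|u Su]; last by apply: vmin; exact/mem_set.
  apply: (space_form_separation hcq); [exact: Xc|exact: Xc|].
  by apply/eqP => /vinj vu; move: vS r0; rewrite /Sph /= vu subrr normr0 => <-; rewrite ltxx.
have B0 : B u0 by rewrite /B /= subrr normr0 ltW.
have [K K0 KP] : exists2 K : R, 0 <= K & forall u, B u -> `|X u| <= K.
  have Xcont : {within B, continuous (fun u => `|X u|)}.
    apply: continuous_in_subspaceT => u /set_mem /rP [Uu _].
    apply: continuous_comp; last exact: norm_continuous.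
    by apply: differentiable_continuous; exact: (sX [::]).
  have [v _ vmax] := EVT_max_rV (ex_intro _ u0 B0) Bcpt Xcont.
  by exists (`|X v|) => // u Bu; apply: vmax; exact/mem_set.
(* A Lipschitz constant for [y |-> f y u] at [X u0], uniform over [B]: all squares being [c], the
   increment is linear in [y - X u0]. *)
pose L := 2 * (n.+2%:R * K) + 1.
have L0 : 0 < L by rewrite ltr_wpDl// mulr_ge0// mulr_ge0.
have fclose y u : space_form c y -> B u -> `|f y u - f (X u0) u| <= L * `|y - X u0|.
  move=> yc Bu; have [Uu _] := rP _ Bu.
  have -> : f y u - f (X u0) u = - (2 * <<X u, y - X u0>>).
    rewrite /f !innerBl !innerBr (space_form_inner hcq yc) (XX Uu) (XX Uu0).
    by rewrite (innerC _ y) (innerC _ (X u0)); ring.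
  have h : `|<<X u, y - X u0>>| <= n.+2%:R * (K * `|y - X u0|).
    by apply: le_trans (normr_inner_le _ _ _) _; rewrite ler_wpM2l// ler_wpM2r//; exact: KP.
  rewrite normrN normrM ger0_norm//.
  have -> : L * `|y - X u0| = 2 * (n.+2%:R * (K * `|y - X u0|)) + `|y - X u0| by rewrite /L; ring.
  by rewrite ler_wpDr// ler_wpM2l.
have t0 : 0 < delta + tau ^+ 2 by rewrite ltr_wpDr// sqr_ge0.
(* The first bound keeps the minimum off the sphere, the second puts its value below the threshold
   of [slice_critical_point]. *)
pose e := Num.min (m / 2) (2 * delta / (delta + tau ^+ 2)) / L.
exists e.
  by rewrite divr_gt0// lt_min !divr_gt0// mulr_gt0.
move=> y yc ay ye.
have [ym yd] : L * `|y - X u0| < m / 2 /\ L * `|y - X u0| < 2 * delta / (delta + tau ^+ 2).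
  by apply/andP; rewrite -lt_min mulrC -ltr_pdivlMr.
have [u1 /set_mem Bu1 u1min] := EVT_min_rV (ex_intro _ u0 B0) Bcpt (fcont y B (fun u h => h)).
have [Uu1 _] := rP _ Bu1.
have fu0 : f y u0 <= L * `|y - X u0|.
  have := fclose y u0 yc B0; rewrite [X in _ - X](_ : _ = 0) ?subr0; last first.
    by rewrite /f subrr inner0l.
  exact/le_trans/ler_norm.
have fu1 : f y u1 <= f y u0 by apply: u1min; exact/mem_set.
(* On the sphere the value would exceed [m / 2], whereas the minimum is at most [f y u0 < m / 2]. *)
have u1r : `|u1 - u0| < r.
  rewrite lt_neqAle Bu1 andbT; apply/eqP => /mP mf.
  have := fclose y u1 yc Bu1; rewrite ler_norml => /andP[h _].
  by move: h; lra.
exists u1 => //.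
have f1 : f y u1 = 0.
  have crit i : <<X_ i u1, y>> = 0.
    have dX i' : is_derive u1 (e_ i') (fun z => X z - y) (X_ i' u1).
      by apply: (is_derive_eq (is_deriveB (derX i' Uu1) (is_derive_cst y u1 (e_ i')))); rewrite subr0.
    have df := is_derive_inner q (dX i) (dX i).
    pose d := r - `|u1 - u0|.
    have dpos : 0 < d by rewrite subr_gt0.
    have inB (t : R) : `|t| < d -> B (t *: (e_ i) + u1).
      move=> td; rewrite /B /= -addrA (le_trans (ler_normD _ _))// -lerBrDr.
      rewrite normrZ (le_trans _ (ltW td))// ler_piMr//.
      apply: normr_row_le => // j; rewrite mxE eqxx /=.
      by case: eqP; rewrite ?normr1 ?normr0.
    have H : <<X_ i u1, X u1 - y>> + <<X u1 - y, X_ i u1>> = 0.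
      apply: derive_at_min dpos _ _ df => t /inB Bt.
        by apply: diff_derivable; apply: fdiff; have [] := rP _ Bt.
      by apply: u1min; exact/mem_set.
    move: H; rewrite (innerC _ (X u1 - y)) innerBr (innerC _ _ (X u1)).
    by rewrite (XX_ i Uu1) => H; lra.
  apply: (@slice_critical_point a tau) => //.
  - exact: (space_form_inner hcq).
  - have [<-|neq] := eqVneq (X u1) y; first by rewrite subrr inner0l.
    by apply/ltW/(space_form_separation hcq) => //; exact: Xc.
  - rewrite -/delta; have : f y u1 < 2 * delta / (delta + tau ^+ 2).
      by rewrite (le_lt_trans fu1)// (le_lt_trans fu0).
    rewrite ltr_pdivlMr// => /lt_le_trans; apply.
    by rewrite ler_pM2r// ler_nat.
apply/eqP; rewrite eq_sym; apply/negPn/negP => neq.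
have := space_form_separation hcq (Xc _ Uu1) yc neq.
by rewrite -/(f y u1) f1 ltxx.
Qed.

End LocalHypersurface.

(** * Global argument *)

Section ConnectedManifold.
Context {R : realType} {n : nat} {M : topologicalType}.
Variable atlas : set (chart R n M).
Hypothesis cover : forall p : M, exists2 phi, atlas phi & src phi p.

Lemma derive_zero_partials (f : 'rV[R]_n -> R) u : differentiable f u ->
  (forall i, partial i f u = 0) -> forall v, 'D_v f u = 0.
Proof.
move=> fu f0 v; rewrite deriveE// (row_sum_delta v) linear_sum big1// => i _.
by rewrite linearZ /= -deriveE// -/(partial i f u) f0 scaler0.
Qed.

(** Coordinate balls are convex, so the segment joining the coordinates of two nearby points stays
    in the chart and [segment_cst] applies. *)
Lemma locally_constant (f : M -> R) p :
  (forall phi, atlas phi -> forall u, tgt phi u ->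
     differentiable (f \o param phi) u /\ forall i, partial i (f \o param phi) u = 0) ->
  \forall p' \near p, f p' = f p.
Proof.
move=> f0; have [phi aphi sp] := cover p.
have ccont : {for p, continuous (coords phi)}.
  have := @coords_continuous _ _ _ phi; rewrite continuous_open_subspace; last exact: src_open.
  by apply; exact/mem_set.
have : \forall v \near coords phi p, tgt phi v.
  by apply: open_nbhs_nbhs; split; [exact: tgt_open|exact: coords_tgt].
move=> /nbhs_normP[r /= r0 rP].
have near_src : \forall p' \near p, src phi p'.
  by apply: open_nbhs_nbhs; split => //; exact: src_open.
have near_ball : \forall p' \near p, `|coords phi p - coords phi p'| < r.
  have /cvgrPdist_lt := ccont; exact.
near=> p'.
have sp' : src phi p' by near: p'.
have cr : `|coords phi p - coords phi p'| < r by near: p'.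
rewrite -(coordsK sp') -(coordsK sp).
have inball (t : R) : 0 <= t <= 1 ->
    tgt phi (t *: (coords phi p' - coords phi p) + coords phi p).
  move=> /andP[t0 t1]; apply: rP; rewrite /ball_ /= opprD addrCA subrr addr0 normrN normrZ ger0_norm//.
  by rewrite distrC (le_lt_trans _ cr)// ler_piMl.
apply: (@segment_cst _ _ (f \o param phi)) => t /inball /(f0 _ aphi)[] // fd fz.
exact: derive_zero_partials.
Unshelve. all: by end_near. Qed.

Lemma connected_constant (f : M -> R) : connected [set: M] ->
  (forall phi, atlas phi -> forall u, tgt phi u ->
     differentiable (f \o param phi) u /\ forall i, partial i (f \o param phi) u = 0) ->
  forall p p', f p = f p'.
Proof.
move=> hc f0 p p'.
(* Local constancy makes the preimage of any set open, hence each fibre is also closed. *)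
have oA (P : set R) : open (f @^-1` P).
  rewrite openE => z Pz; rewrite /interior.
  by apply: filterS (locally_constant z f0) => z' /= ->.
have H : f @^-1` [set f p'] = [set: M].
  apply: hc; first by exists p'.
    by exists (f @^-1` [set f p']); rewrite ?setTI.
  exists (f @^-1` [set f p']); rewrite ?setTI//.
  by rewrite -[X in closed X]setCK; apply: open_closedC; exact: (oA (~` [set f p'])).
by have : [set: M] p by []; rewrite -H.
Qed.

End ConnectedManifold.

(** * Self-adjoint matrices acting on row vectors *)

Section Ambient.
Context {R : realType} {m : nat}.
Variable q : nat.
Implicit Types (A : 'M[R]_m) (v w : 'rV[R]_m).

Lemma is_derive_mxapp (V : normedModType R) A (F : V -> 'rV[R]_m) (u v : V) (dF : 'rV[R]_m) :
  is_derive u v F dF -> is_derive u v (fun z => mxapp A (F z)) (mxapp A dF).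
Proof.
move=> hF; apply: is_derive_row => j.
have E w : mxapp A w 0 j = \sum_k A j k * w 0 k.
  by rewrite !mxE; apply: eq_bigr => k _; rewrite mxE.
rewrite E (_ : (fun z => _) = (fun z => \sum_k cst (A j k) z * F z 0 k)); last first.
  by apply/funext => z; rewrite E.
apply: is_derive_sum_fct => k.
apply: (is_derive_eq (is_derive_mul (is_derive_cst (A j k) u v) (is_derive_coord k hF))).
by rewrite mul0r add0r.
Qed.

Lemma mxapp_scalar y v : mxapp y%:M v = y *: v.
Proof. by rewrite /mxapp mul_scalar_mx linearZ /= trmxK. Qed.

Lemma self_adjoint_scalar y : self_adjoint q (y%:M : 'M[R]_m).
Proof. by move=> v w; rewrite !mxapp_scalar innerZl innerZr. Qed.

Lemma mxappDl A B v : mxapp (A + B) v = mxapp A v + mxapp B v.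
Proof. by rewrite /mxapp mulmxDl linearD. Qed.

Lemma self_adjointD A B : self_adjoint q A -> self_adjoint q B -> self_adjoint q (A + B).
Proof. by move=> sA sB v w; rewrite !mxappDl innerDl innerDr sA sB. Qed.

End Ambient.

(** * Affine position equations and slices on the manifold *)

Section Hypersurface.
Context {R : realType} {n : nat} {M : topologicalType}.
Variables (q : nat) (c : R).
Hypothesis hcq : (c = 1 /\ q = 0%N) \/ (c = -1 /\ q = 1%N).
Hypothesis n0 : (0 < n)%N.
Variable atlas : set (chart R n M).
Hypothesis cover : forall p : M, exists2 phi, atlas phi & src phi p.
Hypothesis M_connected : connected [set: M].
Variables x N : M -> 'rV[R]_n.+2.
Hypotheses (hx : immersed_hypersurface c atlas x) (hN : gauss_map q atlas x N).

Local Notation "<< v , w >>" := (inner q v w) : ring_scope.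

Section Chart.
Variable phi : chart R n M.
Hypothesis aphi : atlas phi.
Local Notation X := (x \o param phi).
Local Notation Nu := (N \o param phi).
Local Notation U := (tgt phi).

Let oU : open U. Proof. exact: tgt_open. Qed.
Let sX : smooth_on U X. Proof. by have [[sx _] _] := hx; exact: sx. Qed.
Let sN : smooth_on U Nu. Proof. by have [sN' _ _ _] := hN; exact: sN'. Qed.
Let XX u : U u -> <<X u, X u>> = c.
Proof. by move=> _; apply: (space_form_inner hcq); have [_] := hx; exact. Qed.
Let NN u : U u -> <<Nu u, Nu u>> = 1.
Proof. by move=> _; have [_ H _ _] := hN; exact: H. Qed.
Let NX u : U u -> <<Nu u, X u>> = 0.
Proof. by move=> _; have [_ _ H _] := hN; exact: H. Qed.
Let NdX u : U u -> forall v, <<Nu u, 'd X u v>> = 0.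
Proof. by have [_ _ _ H] := hN; exact: H. Qed.
Let dX_inj u : U u -> injective ('d X u : 'rV[R]_n -> 'rV[R]_n.+2).
Proof. by have [[_ H] _] := hx; exact: H. Qed.

Local Notation S u := (shape_operator c q X Nu u).

Lemma linearized_position_param k u : U u ->
  linearized_position c q x N phi k (param phi u) =
  \tr (S u *m newton (S u) k) *: Nu u - (c * \tr (newton (S u) k)) *: X u.
Proof.
move=> Uu; apply/rowP => j; rewrite mxE /linearized_at (paramK Uu).
rewrite (linearized_positionE hcq oU sX sN XX NN NX NdX dX_inj k j Uu).
move: (\tr _) (\tr _) => s t.
by rewrite [RHS]mxE [X in _ = X + _]mxE [X in _ = _ + X]mxE [X in _ = _ + - X]mxE.
Qed.

Lemma derX_chart i u : U u -> is_derive u (delta_mx 0 i : 'rV[R]_n) X (lpartial i X u).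
Proof. exact: derX. Qed.

Lemma inner_cst_chart a tau : (forall p, <<a, x p>> = tau) ->
  forall u i, U u -> <<a, lpartial i X u>> = 0.
Proof.
move=> ax u i Uu.
have := partial_inner_cst oU Uu (fun z _ => ax (param phi z)) (is_derive_cst a u (delta_mx 0 i : 'rV[R]_n)) (derX_chart i Uu).
by rewrite inner0l add0r.
Qed.

Lemma inner_chart_cst a (F : M -> 'rV[R]_n.+2) : smooth_on U (F \o param phi) ->
  (forall u i, U u -> <<a, lpartial i (F \o param phi) u>> = 0) ->
  forall u, U u -> differentiable ((fun p => <<a, F p>>) \o param phi) u /\
    forall i, partial i ((fun p => <<a, F p>>) \o param phi) u = 0.
Proof.
move=> sF aF u Uu; have Fu : differentiable (F \o param phi) u by exact: (sF [::]).
split; first exact: differentiable_inner (differentiable_cst a u) Fu.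
move=> i; rewrite -(aF u i Uu) lpartialE.
have H := is_derive_inner q (is_derive_cst a u (delta_mx 0 i : 'rV[R]_n)) (is_derive_partial i Fu).
by have := partial_val H; rewrite inner0l add0r.
Qed.

Lemma slice_normal a tau : (forall p, <<a, x p>> = tau) -> forall u, U u ->
  [/\ a = <<Nu u, a>> *: Nu u + (c * tau) *: X u,
      <<Nu u, a>> ^+ 2 = <<a, a>> - c * tau ^+ 2 &
      <<Nu u, a>> *: S u = (c * tau)%:M].
Proof.
move=> ax u Uu; have aX u' i := @inner_cst_chart _ _ ax u' i.
have [] := constant_normal_field hcq oU sX sN XX NN NX NdX dX_inj aX Uu.
have -> : <<X u, a>> = tau by rewrite innerC; exact: ax.
by move=> h1 h2 h3; split=> //; rewrite h2 addrK.
Qed.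

(** [a] lies in the plane of [N] and [X], and the derivatives of [N] are orthogonal to both. *)
Lemma normal_inner_chart a tau : (forall p, <<a, x p>> = tau) ->
  forall u i, U u -> <<a, lpartial i Nu u>> = 0.
Proof.
move=> ax u i Uu; have [-> _ _] := slice_normal ax Uu.
rewrite innerDl !innerZl (NN_ oU sN NN i Uu).
by rewrite (innerC _ (X u)) (N_X oU sX sN NX NdX i Uu) !mulr0 addr0.
Qed.

Lemma slice_chart a tau u0 : (forall p, <<a, x p>> = tau) ->
  0 < <<a, a>> - c * tau ^+ 2 -> U u0 ->
  exists2 e : R, 0 < e & forall y, space_form c y -> <<a, y>> = tau ->
    `|y - X u0| < e -> range x y.
Proof.
move=> ax d0 Uu0.
have Xc z : U z -> space_form c (X z) by move=> _; have [_] := hx; exact.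
have [e e0 eP] := local_slice hcq oU sX sN XX NN NX NdX dX_inj Uu0 Xc (fun z _ => ax (param phi z)) d0.
by exists e => // y yc ay /(eP _ yc ay)[u Uu ->]; exists (param phi u).
Qed.

(** Differentiating [<A X + b, X> = 0], and using that [A X + b] is normal, gives [<A X_i, X> = 0].
    By self-adjointness [<A X, X_i> = 0], which leaves [<b, X_i>] in [<A X + b, X_i> = 0]. *)
Lemma affine_inner_chart (A : 'M[R]_n.+2) b (m : 'rV[R]_n -> R) : self_adjoint q A ->
  (forall u, U u -> mxapp A (X u) + b = m u *: Nu u) ->
  forall u i, U u -> <<b, lpartial i X u>> = 0.
Proof.
move=> sA AX u i Uu; have Xi := derX_chart i Uu.
have F0 z : U z -> <<mxapp A (X z) + b, X z>> = 0.
  by move=> Uz; rewrite AX// innerZl NX// mulr0.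
have H := partial_inner_cst oU Uu F0 (is_deriveD (is_derive_mxapp A Xi) (is_derive_cst b u _)) Xi.
have G : <<mxapp A (X u) + b, lpartial i X u>> = 0.
  by rewrite AX// innerZl (NX_ sX NdX i Uu) mulr0.
move: H; rewrite addr0 G addr0 sA innerC => H.
by move: G; rewrite innerDl H add0r.
Qed.

Lemma trace_newton_chart k u : (k <= n)%N -> U u ->
  \tr (newton (S u) k) = (n - k)%:R * sym_curv (S u) k.
Proof.
by move=> kn Uu; apply: trace_newton => //; exact: (shape_split hcq oU sX sN XX NX NdX dX_inj Uu).
Qed.

Lemma trace_mul_newton_chart k u : (k < n)%N -> U u ->
  \tr (S u *m newton (S u) k) = k.+1%:R * sym_curv (S u) k.+1.
Proof.
by move=> kn Uu; apply: trace_mul_newton => //; exact: (shape_split hcq oU sX sN XX NX NdX dX_inj Uu).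
Qed.

End Chart.

Lemma inner_position_cst b :
  (forall phi, atlas phi -> forall u i, tgt phi u -> <<b, lpartial i (x \o param phi) u>> = 0) ->
  forall p p', <<b, x p>> = <<b, x p'>>.
Proof.
move=> bX; apply: (connected_constant cover M_connected) => phi aphi.
by apply: inner_chart_cst; [have [[sx _] _] := hx; exact: sx|exact: bX].
Qed.

Lemma inner_normal_cst a tau : (forall p, <<a, x p>> = tau) ->
  forall p p', <<a, N p>> = <<a, N p'>>.
Proof.
move=> ax; apply: (connected_constant cover M_connected) => phi aphi.
apply: inner_chart_cst; first by have [sN _ _ _] := hN; exact: sN.
exact: (normal_inner_chart aphi ax).
Qed.

Lemma scalar_mx_eq0 (y : R) : y%:M = 0 :> 'M[R]_n -> y = 0.
Proof.
by move=> /matrixP/(_ (Ordinal n0) (Ordinal n0)); rewrite !mxE eqxx.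
Qed.

Lemma affine_slice (k : nat) (A : 'M[R]_n.+2) b (h : R) (p0 : M) : (k < n)%N ->
  self_adjoint q A -> b != 0 ->
  (forall phi, atlas phi -> forall p, src phi p -> mean_curvature_at c q x N phi k p = h) ->
  (forall phi, atlas phi -> forall p, src phi p ->
     linearized_position c q x N phi k p = mxapp A (x p) + b) ->
  exists tau, [/\ forall p, <<b, x p>> = tau, tau != 0 & 0 < <<b, b>> - c * tau ^+ 2].
Proof.
move=> kn sA b0 hH LA.
pose S phi u := shape_operator c q (x \o param phi) (N \o param phi) u.
(* The constant trace of [P_k], since [s_k] is ['C(n, k)] times [H_k]. *)
pose T := (n - k)%:R * ('C(n, k)%:R * h).
have trP phi u : atlas phi -> tgt phi u -> \tr (newton (S phi u) k) = T.
  move=> aphi Uu; rewrite (trace_newton_chart aphi (ltnW kn) Uu); congr (_ * _).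
  rewrite -(hH _ aphi _ (param_src Uu)) /mean_curvature_at /mean_curvature (paramK Uu).
  by rewrite mulrC divfK// pnatr_eq0 -lt0n bin_gt0 ltnW.
pose B := A + (c * T)%:M.
have sB : self_adjoint q B by apply: self_adjointD => //; exact: self_adjoint_scalar.
have BX phi u : atlas phi -> tgt phi u -> mxapp B (x (param phi u)) + b =
    \tr (S phi u *m newton (S phi u) k) *: N (param phi u).
  move=> aphi Uu; have := LA _ aphi _ (param_src Uu).
  rewrite (linearized_position_param aphi k Uu) (trP _ _ aphi Uu) /= => /eqP.
  rewrite subr_eq => /eqP ->; rewrite mxappDl mxapp_scalar.
  by rewrite -!addrA; congr (_ + _); exact: addrC.
have bX phi (aphi : atlas phi) u i : tgt phi u -> <<b, lpartial i (x \o param phi) u>> = 0.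
  exact: (affine_inner_chart aphi sB (BX phi ^~ aphi)).
have bx p : <<b, x p>> = <<b, x p0>> by exact: inner_position_cst.
have normal p : exists phi u, [/\ atlas phi, tgt phi u, param phi u = p &
    [/\ b = <<N p, b>> *: N p + (c * <<b, x p0>>) *: x p,
      <<N p, b>> ^+ 2 = <<b, b>> - c * <<b, x p0>> ^+ 2 &
      <<N p, b>> *: S phi u = (c * <<b, x p0>>)%:M]].
  have [phi aphi sp] := cover p; exists phi, (coords phi p).
  have := slice_normal aphi bx (coords_tgt sp); rewrite /= (coordsK sp) => H.
  by split=> //; exact: coords_tgt.
have cc := c_sqr hcq.
(* If [<N, b> = 0], the slice relation gives [c tau I = 0], hence [c tau = 0] as [0 < n], and then
   [b = 0]. *)
have beta0 p : <<N p, b>> != 0.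
  apply: contra b0 => /eqP be0; have [phi [u [_ _ _ []]]] := normal p.
  rewrite be0 !scale0r add0r => bE _ /esym /scalar_mx_eq0 ct.
  by apply/eqP; rewrite bE ct scale0r.
have delta0 : 0 < <<b, b>> - c * <<b, x p0>> ^+ 2.
  have [phi [u [_ _ _ [_ <- _]]]] := normal p0.
  by rewrite lt_neqAle eq_sym sqrf_eq0 beta0 sqr_ge0.
exists <<b, x p0>>; split => //.
apply/eqP => tau0.
have bb0 : 0 < <<b, b>> by move: delta0; rewrite tau0 expr0n mulr0 subr0.
have S0 phi u : atlas phi -> tgt phi u -> S phi u = 0.
  move=> aphi Uu; have [_ _] := slice_normal aphi bx Uu.
  rewrite tau0 mulr0 raddf0 => /eqP; rewrite scaler_eq0 (negbTE (beta0 _)) /=.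
  by move/eqP.
(* [w] pairs with [x] to the constant [- <b, b>], so it defines a second slice through the image;
   with [S = 0] its relation forces that constant to vanish. *)
pose w := mxapp B b.
have wx p : <<w, x p>> = - <<b, b>>.
  have [phi aphi sp] := cover p.
  have := BX _ _ aphi (coords_tgt sp); rewrite (S0 _ _ aphi (coords_tgt sp)) mul0mx raddf0 scale0r.
  rewrite (coordsK sp) => /eqP; rewrite addr_eq0 => /eqP Bx.
  by rewrite /w sB Bx innerNr.
have [phi aphi sp] := cover p0.
have [_ _] := slice_normal aphi wx (coords_tgt sp).
rewrite -/(S phi (coords phi p0)) (S0 _ _ aphi (coords_tgt sp)) scaler0 => /esym /scalar_mx_eq0.
move=> /(congr1 (fun z => c * z)); rewrite mulrA cc mul1r mulr0 => /eqP.
by rewrite oppr_eq0 gt_eqF.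
Qed.

(** [be = <N, a>] is constant, so [S = la I] with [la = c tau / be] and [N = (a - c tau x) / be];
    inserting both into the formula for [L_k x] gives the matrix and the vector. *)
Lemma slice_affine (k : nat) a tau (p0 : M) : (k < n)%N ->
  (forall p, <<a, x p>> = tau) -> tau != 0 -> 0 < <<a, a>> - c * tau ^+ 2 ->
  exists (A : 'M[R]_n.+2) (b : 'rV[R]_n.+2), [/\ self_adjoint q A, b != 0 &
    forall phi, atlas phi -> forall p, src phi p ->
      linearized_position c q x N phi k p = mxapp A (x p) + b].
Proof.
move=> kn ax tau0 d0; have cc := c_sqr hcq.
have c0 : c != 0 by apply/eqP => c0; move/eqP: cc; rewrite c0 mul0r eq_sym oner_eq0.
pose be := <<N p0, a>>.
have beE p : <<N p, a>> = be.
  by rewrite /be innerC (innerC _ (N p0)); exact: (inner_normal_cst ax).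
have be2 : be ^+ 2 = <<a, a>> - c * tau ^+ 2.
  have [phi aphi sp] := cover p0; have [_ + _] := slice_normal aphi ax (coords_tgt sp).
  by rewrite /= beE.
have be0 : be != 0 by rewrite -sqrf_eq0 be2 gt_eqF.
pose la := c * tau / be.
have la0 : la != 0 by rewrite /la !mulf_neq0// invr_eq0.
pose m1 := \tr ((la%:M : 'M[R]_n) *m newton la%:M k).
pose m2 := \tr (newton (la%:M : 'M[R]_n) k).
have SE phi u : atlas phi -> tgt phi u ->
    shape_operator c q (x \o param phi) (N \o param phi) u = la%:M.
  move=> aphi Uu; have [_ _] := slice_normal aphi ax Uu; rewrite /= beE.
  move=> /(congr1 (fun C => be^-1 *: C)); rewrite scalerA mulVf// scale1r => ->.
  by rewrite scale_scalar_mx /la mulrC.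
(* This makes the vector nonzero: [m1] is a positive integer times [la ^+ k.+1], the binomial being
   nonzero as [k < n]. *)
have m10 : m1 != 0.
  have [phi aphi sp] := cover p0; have Uu := coords_tgt sp.
  have := trace_mul_newton_chart aphi kn Uu; rewrite (SE _ _ aphi Uu) -/m1 => ->.
  by rewrite sym_curv_scalar !mulf_neq0 ?pnatr_eq0 ?expf_neq0// -lt0n bin_gt0.
exists (- (m1 * la + c * m2))%:M, ((m1 / be) *: a); split.
- exact: self_adjoint_scalar.
- rewrite scaler_eq0 negb_or mulf_neq0 ?invr_eq0//=.
  by apply: contra tau0 => /eqP a0; rewrite -(ax p0) a0 inner0l.
move=> phi aphi p sp; have Uu := coords_tgt sp.
rewrite -{1}(coordsK sp) (linearized_position_param aphi k Uu) /= (coordsK sp) (SE _ _ aphi Uu) -/m1 -/m2.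
have [aE _ _] := slice_normal aphi ax Uu; rewrite /= (coordsK sp) beE in aE.
rewrite mxapp_scalar aE scalerDr !scalerA.
rewrite (_ : m1 / be * be = m1); last by rewrite divfK.
rewrite (_ : m1 / be * (c * tau) = m1 * la); last by rewrite /la; ring.
by rewrite addrCA -scalerDl -scaleNr; congr (_ + _ *: _); ring.
Qed.

Lemma slice_open_piece a tau : (forall p, <<a, x p>> = tau) ->
  0 < <<a, a>> - c * tau ^+ 2 ->
  open_piece x (space_form c `&` [set y | <<a, y>> = tau]).
Proof.
move=> ax d0.
(* Points with admissible radii; the union over all such pairs avoids choosing a radius per
   point. *)
pose good (pe : M * R) := 0 < pe.2 /\ forall y, space_form c y -> <<a, y>> = tau ->
  `|y - x pe.1| < pe.2 -> range x y.
exists (\bigcup_(pe in good) ball (x pe.1) pe.2).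
  by apply: bigcup_open => pe [e0 _]; exact: ball_open.
apply/seteqP; split=> [_ [p _ <-]|y [[yc ay] [[p e] [/= e0 ep]]]].
  split; first by split; [have [_] := hx; exact|exact: ax].
  have [phi aphi sp] := cover p.
  have [e e0 eP] := slice_chart aphi ax d0 (coords_tgt sp).
  exists (p, e); first by split=> //= y yc ay; rewrite -{1}(coordsK sp); exact: eP.
  exact: ballxx.
by rewrite -ball_normE /= distrC => /ep; exact.
Qed.

End Hypersurface.

(** * Slices and the listed umbilical hypersurfaces *)

Lemma space_formN1 (R : realType) (n : nat) : @space_form R n (-1) = hyperbolic.
Proof. by rewrite /space_form; case: eqP => // H; exfalso; lra. Qed.

Theorem theorem1p7 (R : realType) (n k q : nat) (c : R)
  (hcq : (c = 1 /\ q = 0%N) \/ (c = -1 /\ q = 1%N))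
  (hk : (k < n)%N)
  (M : topologicalType) (atlas : set (chart R n M))
  (hM : smooth_manifold atlas)
  (hM0 : [set: M] !=set0)
  (hMc : connected [set: M])
  (x N : M -> 'rV[R]_n.+2)
  (hx : immersed_hypersurface c atlas x)
  (hN : gauss_map q atlas x N)
  (hH : constant_mean_curvature c q atlas x N k) :
  (exists (A : 'M[R]_n.+2) (b : 'rV[R]_n.+2),
     [/\ self_adjoint q A, b != 0
       & forall phi, atlas phi -> forall p, src phi p ->
           linearized_position c q x N phi k p = mxapp A (x p) + b])
  <->
  ((c = 1 /\
    exists (r : R) (Sigma : set 'rV[R]_n.+2),
      [/\ 0 < r < 1, umbilical_sphere_in_sphere r Sigma
        & open_piece x Sigma])
   \/
   (c = -1 /\
    [\/ exists (r : R) (Sigma : set 'rV[R]_n.+2),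
          [/\ 1 < r, umbilical_hyperbolic_in_hyperbolic r Sigma
            & open_piece x Sigma],
        exists (r : R) (Sigma : set 'rV[R]_n.+2),
          [/\ 0 < r, umbilical_sphere_in_hyperbolic r Sigma
            & open_piece x Sigma]
      | exists Sigma : set 'rV[R]_n.+2,
          umbilical_euclidean_in_hyperbolic Sigma /\ open_piece x Sigma])).
Proof.
have n0 : (0 < n)%N by exact: leq_ltn_trans hk.
have [_ _ [cover _]] := hM; have [p0 _] := hM0.
have on_slice a tau (Sigma : set 'rV[R]_n.+2) : open_piece x Sigma ->
    Sigma = space_form c `&` [set y | inner q a y = tau] -> forall p, inner q a (x p) = tau.
  move=> [V _ rV] SE p; have : range x (x p) by exists p.
  by rewrite rV SE => -[[]].
split.
  move=> [A [b [sA b0 LA]]]; have [h hh] := hH.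
  have [tau [bx tau0 d0]] := affine_slice hcq n0 cover hMc hx hN p0 hk sA b0 hh LA.
  (* Rescaling [b] and [tau] together preserves the slice, which allows normalizing [<a, a>] to 1 or
     -1. *)
  have piece l : l != 0 -> open_piece x (space_form c `&` [set y | inner q (l *: b) y = l * tau]).
    move=> l0; apply: (slice_open_piece hcq cover hx hN) => [p|]; first by rewrite innerZl bx.
    rewrite !innerZl innerZr; have -> : l * (l * inner q b b) - c * (l * tau) ^+ 2 =
      l ^+ 2 * (inner q b b - c * tau ^+ 2) by ring.
    by rewrite mulr_gt0// lt_neqAle eq_sym sqrf_eq0 l0 sqr_ge0.
  have scale (s : R) : 0 < s -> exists2 l : R, l != 0 & l ^+ 2 * s = 1.
    move=> s0; exists (Num.sqrt s)^-1; first by rewrite invr_eq0 gt_eqF// sqrtr_gt0.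
    by rewrite exprVn sqr_sqrtr ?mulVf ?gt_eqF ?ltW.
  have nonempty Sigma : open_piece x Sigma -> Sigma !=set0.
    move=> [V _ rV]; have xp : range x (x p0) by exists p0.
    by exists (x p0); move: xp; rewrite rV => -[].
  have tau2 : 0 < tau ^+ 2 by rewrite lt_neqAle eq_sym sqrf_eq0 tau0 sqr_ge0.
  move: hcq d0 piece => [[-> ->]|[-> ->]] d0 piece; [left|right]; split=> //.
    have s0 : 0 < inner 0 b b by move: d0; lra.
    have [l l0 ls] := scale _ s0.
    have l2 : 0 < l ^+ 2 by rewrite lt_neqAle eq_sym sqrf_eq0 l0 sqr_ge0.
    have lt0 : 0 < (l * tau) ^+ 2 by rewrite exprMn mulr_gt0.
    have lt1 : (l * tau) ^+ 2 < 1 by rewrite exprMn -ls ltr_pM2l//; move: d0; lra.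
    exists (Num.sqrt (1 - (l * tau) ^+ 2)), (sphere_slice (l *: b) (l * tau)); split.
    - by rewrite sqrtr_gt0 subr_gt0 lt1 -[ltRHS]sqrtr1 ltr_sqrt ?ltr01// gtrBl.
    - exists (l *: b), (l * tau); split=> //; first by rewrite innerZl innerZr mulrA -expr2.
      by move: lt1; set t := l * tau => h1; apply/andP; split; nra.
    - by have := piece l l0; rewrite /space_form eqxx.
  have hslice a t : hyperbolic_slice a t = space_form (-1) `&` [set y | inner 1 a y = t].
    by rewrite space_formN1.
  (* The causal character of [b] decides the type: timelike gives round spheres, spacelike
     hyperbolic spaces, null Euclidean spaces. *)
  have [s0|s0|s0] := ltgtP (inner 1 b b) 0.
  - have [l l0 ls] : exists2 l : R, l != 0 & l ^+ 2 * - inner 1 b b = 1.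
      by apply: scale; rewrite oppr_gt0.
    have l2 : 0 < l ^+ 2 by rewrite lt_neqAle eq_sym sqrf_eq0 l0 sqr_ge0.
    have lt1 : 1 < (l * tau) ^+ 2 by rewrite exprMn -ls ltr_pM2l//; move: d0; lra.
    constructor 2; exists (Num.sqrt ((l * tau) ^+ 2 - 1)), (hyperbolic_slice (l *: b) (l * tau)).
    split; [by rewrite sqrtr_gt0 subr_gt0| |by rewrite hslice; exact: piece].
    exists (l *: b), (l * tau); split=> //.
    + by rewrite innerZl innerZr mulrA -expr2; move: ls; lra.
    + rewrite ltNge; apply/negP => h1; move: lt1; rewrite -(real_normK (num_real (l * tau))).
      by move: h1 (normr_ge0 (l * tau)); move: `|l * tau| => y; nra.
    + by rewrite hslice; apply/nonempty/piece.
  - have [l l0 ls] := scale _ s0.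
    have l2 : 0 < l ^+ 2 by rewrite lt_neqAle eq_sym sqrf_eq0 l0 sqr_ge0.
    constructor 1; exists (Num.sqrt (1 + (l * tau) ^+ 2)), (hyperbolic_slice (l *: b) (l * tau)).
    split; [|  |by rewrite hslice; exact: piece].
      have lt0 : 0 < (l * tau) ^+ 2 by rewrite exprMn mulr_gt0.
      by rewrite -[ltLHS]sqrtr1 ltr_sqrt; move: ((l * tau) ^+ 2) lt0 => t; lra.
    exists (l *: b), (l * tau); split=> //; first by rewrite innerZl innerZr mulrA -expr2.
    by rewrite hslice; apply/nonempty/piece.
  - constructor 3; exists (hyperbolic_slice b tau).
    have P : open_piece x (hyperbolic_slice b tau).
      by have := piece 1 (oner_neq0 _); rewrite hslice scale1r mul1r.
    by split=> //; exists b, tau; split=> //; exact: nonempty.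
(* For the converse, each listed hypersurface has to supply [tau != 0] and the positivity of
   [<a, a> - c tau^2]. *)
have concl a tau : (forall p, inner q a (x p) = tau) -> tau != 0 -> 0 < inner q a a - c * tau ^+ 2 ->
    exists (A : 'M[R]_n.+2) (b : 'rV[R]_n.+2), [/\ self_adjoint q A, b != 0
       & forall phi, atlas phi -> forall p, src phi p ->
           linearized_position c q x N phi k p = mxapp A (x p) + b].
  exact: (slice_affine hcq cover hMc hx hN p0 hk).
move: hcq on_slice concl => [[cE qE]|[cE qE]] on_slice concl.
  case=> [[_ [r [Sigma [/andP[r0 r1] [a [tau [aa /andP[t1 t2] rE SE]]] op]]]]|[cN _]]; last first.
    by move: cN; rewrite cE => /eqP; rewrite eq_sym; lra.
  apply: (concl a tau).
  - by apply: (on_slice _ _ _ op); rewrite SE cE qE /space_form eqxx.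
  (* [r < 1] excludes the great spheres. *)
  - by apply/eqP => t0; move: r1; rewrite rE t0 expr0n subr0 sqrtr1 ltxx.
  - by rewrite qE cE aa; nra.
case=> [[cN _]|[_ H]]; first by move: cN; rewrite cE => /eqP; lra.
case: H => [[r [Sigma [r1 [a [tau [aa rE SE _]]] op]]]|[r [Sigma [r0 [a [tau [aa t1 rE SE _]]] op]]]|[Sigma [[a [tau [a0 aa t0 SE _]]] op]]];
  apply: (concl a tau); try (by apply: (on_slice _ _ _ op); rewrite SE cE qE space_formN1).
(* [1 < r] excludes the totally geodesic slices. *)
- by apply/eqP => t0; move: r1; rewrite rE t0 expr0n addr0 sqrtr1 ltxx.
- by rewrite qE cE aa; have := sqr_ge0 tau; lra.
- by apply/eqP => t0; move: t1; rewrite t0 normr0; lra.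
- rewrite qE cE aa; have : 1 < tau ^+ 2 by rewrite -real_normK ?num_real// exprn_egt1.
  by lra.
- by [].
- rewrite qE cE aa; have : 0 < tau ^+ 2 by rewrite lt_neqAle eq_sym sqrf_eq0 t0 sqr_ge0.
  by lra.
Qed.
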